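(* Let $E$ be a row-finite graph and $k$ a field. There is a one-to-one, inclusion-preserving correspondence between the set of graded prime ideals of the Leavitt path algebra $L_k(E)$ and the set of $\mathbb Z$-prime order ideals of the $\mathbb Z$-monoid $\mathcal V^{\mathrm{gr}}(L_k(E))$.
   Context: A graph $E=(E^0,E^1,r,s)$ has vertex set $E^0$, edge set $E^1$, range and source maps $r,s:E^1\to E^0$; it is row-finite if $s^{-1}(v)$ is finite for all $v\in E^0$; a sink is a vertex $v$ with $s^{-1}(v)=\emptyset$. The Leavitt path algebra $L_k(E)$ is the $k$-algebra generated by $E^0\cup E^1\cup\{e^*:e\in E^1\}$ subject to $vw=\delta_{v,w}v$, $s(e)e=e=er(e)$, $r(e)e^*=e^*=e^*s(e)$, $e^*f=\delta_{e,f}r(e)$, and $v=\sum_{e\in s^{-1}(v)}ee^*$ for every non-sink $v$; it is $\mathbb Z$-graded with $\deg v=0$, $\deg e=1$, $\deg e^*=-1$. $\mathcal V^{\mathrm{gr}}(L_k(E))$ is the commutative monoid of isomorphism classes of graded finitely generated projective $L_k(E)$-modules under direct sum, with $\mathbb Z$ acting by shifts ${}^n[P]=[P(n)]$, where $P(n)_\gamma=P_{\gamma+n}$. For a commutative monoid $M$ with an action of $\mathbb Z$, write $a\le b$ if $b=a+c$ for some $c\in M$; a $\mathbb Z$-order ideal is a submonoid $N$ closed under the action and such that $a\le b$, $b\in N$ imply $a\in N$. A $\mathbb Z$-order ideal $N$ is $\mathbb Z$-prime if for all $\mathbb Z$-order ideals $N_1,N_2$, $N_1\cap N_2\subseteq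 N$ implies $N_1\subseteq N$ or $N_2\subseteq N$. A graded prime ideal of $L_k(E)$ is a graded two-sided ideal $P$ such that for all graded ideals $I,J$, $IJ\subseteq P$ implies $I\subseteq P$ or $J\subseteq P$. *)

(* Defs.v *)
From HB Require Import structures.
From mathcomp Require Import all_boot all_algebra.
From Stdlib Require List.

Set Implicit Arguments.
Unset Strict Implicit.
Unset Printing Implicit Defensive.
Import GRing.Theory.
Local Open Scope ring_scope.

Record graph := Graph {
  vert : Type;
  edge : Type;
  src  : edge -> vert;
  rng  : edge -> vert }.

Definition row_finite (E : graph) : Prop :=
  forall v : vert E, exists l : seq (edge E),
    List.NoDup l /\ forall e, src e = v <-> List.In e l.

Definition is_sink (E : graph) (v : vert E) : Prop := forall e, src e <> v.

(* (Possibly non-unital) associative k-algebras: L_k(E) is unital only *)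
(* when E^0 is finite, so we cannot use MathComp's (unital) algType.   *)
Record nualg (k : fieldType) := NUAlg {
  ncar :> lmodType k;
  nmul : ncar -> ncar -> ncar;
  nmulA : forall x y z, nmul x (nmul y z) = nmul (nmul x y) z;
  nmulDl : forall x y z, nmul (x + y) z = nmul x z + nmul y z;
  nmulDr : forall x y z, nmul x (y + z) = nmul x y + nmul x z;
  nmulZl : forall (a : k) x y, nmul (a *: x) y = a *: nmul x y;
  nmulZr : forall (a : k) x y, nmul x (a *: y) = a *: nmul x y }.

Arguments nmul {k} n _ _.

Definition nualg_hom (k : fieldType) (A B : nualg k) (h : A -> B) : Prop :=
  (forall (a : k) (x y : A), h (a *: x + y) = a *: h x + h y) /\
  (forall x y : A, h (nmul A x y) = nmul B (h x) (h y)).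

(* A family of elements indexed by E^0 (vertices), E^1 (edges) and    *)
(* the ghost edges e^*.                                                *)
Record lfam (E : graph) (k : fieldType) (B : nualg k) := LFam {
  fv : vert E -> B;
  fe : edge E -> B;
  fs : edge E -> B }.

Definition leavitt_family (E : graph) (k : fieldType) (B : nualg k)
    (F : lfam E B) : Prop :=
  (forall v, nmul B (fv F v) (fv F v) = fv F v) /\
  (forall v w, v <> w -> nmul B (fv F v) (fv F w) = 0) /\
  (forall e, nmul B (fv F (src e)) (fe F e) = fe F e /\
             nmul B (fe F e) (fv F (rng e)) = fe F e) /\
  (forall e, nmul B (fv F (rng e)) (fs F e) = fs F e /\
             nmul B (fs F e) (fv F (src e)) = fs F e) /\
  (forall e, nmul B (fs F e) (fe F e) = fv F (rng e)) /\
  (forall e f, e <> f -> nmul B (fs F e) (fe F f) = 0) /\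
  (forall v (l : seq (edge E)), ~ is_sink v -> List.NoDup l ->
         (forall e, src e = v <-> List.In e l) ->
         fv F v = \sum_(e <- l) nmul B (fe F e) (fs F e)).

Definition is_leavitt_path_algebra (E : graph) (k : fieldType) (A : nualg k)
    (F : lfam E A) : Prop :=
  leavitt_family F /\
  forall (B : nualg k) (G : lfam E B), leavitt_family G ->
    (exists h : A -> B, nualg_hom h /\
       (forall v, h (fv F v) = fv G v) /\
       (forall e, h (fe F e) = fe G e) /\
       (forall e, h (fs F e) = fs G e)) /\
    (forall h1 h2 : A -> B, nualg_hom h1 -> nualg_hom h2 ->
       (forall v, h1 (fv F v) = h2 (fv F v)) ->
       (forall e, h1 (fe F e) = h2 (fe F e)) ->
       (forall e, h1 (fs F e) = h2 (fs F e)) ->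
       forall x, h1 x = h2 x).

Inductive gen (E : graph) :=
  | GV of vert E | GE of edge E | GS of edge E.

Definition gen_deg (E : graph) (g : gen E) : int :=
  match g with GV _ => 0 | GE _ => 1 | GS _ => -1 end.

Definition gen_val (E : graph) (k : fieldType) (A : nualg k) (F : lfam E A)
    (g : gen E) : A :=
  match g with GV v => fv F v | GE e => fe F e | GS e => fs F e end.

(* nonempty words (head, tail) in the generators *)
Definition word_val (E : graph) (k : fieldType) (A : nualg k) (F : lfam E A)
    (w : gen E * seq (gen E)) : A :=
  foldl (fun x g => nmul A x (gen_val F g)) (gen_val F w.1) w.2.

Definition word_deg (E : graph) (w : gen E * seq (gen E)) : int :=
  gen_deg w.1 + \sum_(g <- w.2) gen_deg g.

Definition homog (E : graph) (k : fieldType) (A : nualg k) (F : lfam E A)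
    (n : int) (x : A) : Prop :=
  exists s : seq (k * (gen E * seq (gen E))),
    (forall p, List.In p s -> word_deg p.2 = n) /\
    x = \sum_(p <- s) p.1 *: word_val F p.2.

Definition two_sided_ideal (k : fieldType) (A : nualg k) (I : A -> Prop) :=
  [/\ I 0, (forall x y, I x -> I y -> I (x - y)) &
      (forall a x, I x -> I (nmul A a x) /\ I (nmul A x a))].

Definition graded_ideal (E : graph) (k : fieldType) (A : nualg k)
    (F : lfam E A) (I : A -> Prop) : Prop :=
  two_sided_ideal I /\
  forall x, I x -> exists s : seq (int * A),
    (forall p, List.In p s -> homog F p.1 p.2 /\ I p.2) /\
    x = \sum_(p <- s) p.2.

Definition graded_prime (E : graph) (k : fieldType) (A : nualg k)
    (F : lfam E A) (P : A -> Prop) : Prop :=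
  graded_ideal F P /\
  forall I J : A -> Prop, graded_ideal F I -> graded_ideal F J ->
    (forall a b, I a -> J b -> P (nmul A a b)) ->
    (forall x, I x -> P x) \/ (forall x, J x -> P x).

Record grmod (E : graph) (k : fieldType) (A : nualg k) (F : lfam E A) := GrMod {
  gcar :> zmodType;
  gact : A -> gcar -> gcar;
  gactDl : forall a b m, gact (a + b) m = gact a m + gact b m;
  gactDr : forall a m n, gact a (m + n) = gact a m + gact a n;
  gactA  : forall a b m, gact (nmul A a b) m = gact a (gact b m);
  gunital : forall m, exists s : seq (A * gcar), m = \sum_(p <- s) gact p.1 p.2;
  gcomp : int -> gcar -> Prop;
  gcomp0 : forall g, gcomp g 0;
  gcompB : forall g x y, gcomp g x -> gcomp g y -> gcomp g (x - y);
  gdec : forall m, exists s : seq (int * gcar),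
           uniq (map fst s) /\ (forall p, List.In p s -> gcomp p.1 p.2) /\
           m = \sum_(p <- s) p.2;
  gindep : forall s : seq (int * gcar), uniq (map fst s) ->
           (forall p, List.In p s -> gcomp p.1 p.2) ->
           \sum_(p <- s) p.2 = 0 -> forall p, List.In p s -> p.2 = 0;
  gcompat : forall g h a m, homog F g a -> gcomp h m -> gcomp (g + h) (gact a m) }.

Arguments gact {E k A F} _ _ _.
Arguments gcomp {E k A F} _ _ _.

Definition grhom (E : graph) (k : fieldType) (A : nualg k) (F : lfam E A)
    (M N : grmod F) (f : M -> N) : Prop :=
  [/\ (forall x y, f (x + y) = f x + f y),
      (forall a x, f (gact M a x) = gact N a (f x)) &
      (forall g x, gcomp M g x -> gcomp N g (f x))].

Definition gr_iso (E : graph) (k : fieldType) (A : nualg k) (F : lfam E A)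
    (M N : grmod F) : Prop :=
  exists f : M -> N, grhom f /\ bijective f /\
    (forall g x, gcomp N g (f x) -> gcomp M g x).

(* N is isomorphic to the shift M(n), where M(n)_gamma = M_(gamma+n) *)
Definition shift_iso (E : graph) (k : fieldType) (A : nualg k) (F : lfam E A)
    (n : int) (M N : grmod F) : Prop :=
  exists f : M -> N,
    [/\ (forall x y, f (x + y) = f x + f y),
        (forall a x, f (gact M a x) = gact N a (f x)),
        bijective f &
        (forall g x, gcomp M (g + n) x <-> gcomp N g (f x))].

Definition gr_biprod (E : graph) (k : fieldType) (A : nualg k) (F : lfam E A)
    (P Q R : grmod F) : Prop :=
  exists (iP : P -> R) (iQ : Q -> R) (pP : R -> P) (pQ : R -> Q),
    grhom iP /\ grhom iQ /\ grhom pP /\ grhom pQ /\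
    (forall x, pP (iP x) = x) /\ (forall y, pQ (iQ y) = y) /\
    (forall z, iP (pP z) + iQ (pQ z) = z).

Definition gr_fin_gen (E : graph) (k : fieldType) (A : nualg k) (F : lfam E A)
    (M : grmod F) : Prop :=
  exists ms : seq M, forall m, exists s : seq (A * M),
    (forall p, List.In p s -> List.In p.2 ms) /\
    m = \sum_(p <- s) gact M p.1 p.2.

Definition gr_projective (E : graph) (k : fieldType) (A : nualg k)
    (F : lfam E A) (P : grmod F) : Prop :=
  forall (N N' : grmod F) (p : N -> N') (f : P -> N'),
    grhom p -> (forall y, exists x, p x = y) -> grhom f ->
    exists g : P -> N, grhom g /\ forall x, p (g x) = f x.

Definition gr_fgp (E : graph) (k : fieldType) (A : nualg k) (F : lfam E A)
    (P : grmod F) : Prop := gr_fin_gen P /\ gr_projective P.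

(* Subsets of V^gr(A) (the monoid of isomorphism classes of graded     *)
(* f.g. projective modules) are represented as isomorphism-invariant   *)
(* predicates on graded f.g. projective modules.                       *)
Definition Zorder_ideal (E : graph) (k : fieldType) (A : nualg k)
    (F : lfam E A) (N : grmod F -> Prop) : Prop :=
  (forall P, N P -> gr_fgp P) /\
  (forall P Q, gr_fgp Q -> gr_iso P Q -> N P -> N Q) /\
  (forall Z : grmod F, gr_fgp Z -> (forall x : Z, x = 0) -> N Z) /\
  (forall P Q R, gr_fgp P -> gr_fgp Q -> gr_fgp R -> gr_biprod P Q R ->
     N P -> N Q -> N R) /\
  (forall P Q R, gr_fgp P -> gr_fgp Q -> gr_fgp R -> gr_biprod P Q R ->
     N R -> N P) /\
  (forall (n : int) P Q, gr_fgp Q -> shift_iso n P Q -> N P -> N Q).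

Definition Zprime_ideal (E : graph) (k : fieldType) (A : nualg k)
    (F : lfam E A) (N : grmod F -> Prop) : Prop :=
  Zorder_ideal N /\
  forall N1 N2 : grmod F -> Prop, Zorder_ideal N1 -> Zorder_ideal N2 ->
    (forall P, N1 P -> N2 P -> N P) ->
    (forall P, N1 P -> N P) \/ (forall P, N2 P -> N P).

Definition gprimes (E : graph) (k : fieldType) (A : nualg k) (F : lfam E A) :=
  {P : A -> Prop | graded_prime F P}.

Definition zprimes (E : graph) (k : fieldType) (A : nualg k) (F : lfam E A) :=
  {N : grmod F -> Prop | Zprime_ideal N}.

(* Main.v *)
(** An order ideal [N] of graded modules has a trace ideal, the sum of the images
    of all homogeneous maps from members of [N] to the algebra; a graded ideal
    [I] has the class of the finitely generated projective [P] with [I P = P].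
    If [P] equals its product with the trace of [N], then [P] is the image of a
    finite sum of shifts of members of [N], hence by projectivity a direct
    summand of it and so in [N]; a dual basis of [P] gives the converse.
    Conversely, a graded ideal of a Leavitt path algebra is generated by the
    vertices [v] that it contains, and each of these is in the trace of the
    projective module [A v].  So both maps are inverse lattice isomorphisms, and
    primeness is transported because [I P = P = J P] implies [(I J) P = P]. *)

From HB Require Import structures.
Require Import Defs.
From mathcomp Require Import all_boot all_algebra.
From mathcomp Require Import boolp functions.
From Stdlib Require List.

Set Implicit Arguments.
Unset Strict Implicit.
Unset Printing Implicit Defensive.
Import GRing.Theory.
Local Open Scope ring_scope.

(** The algebra is known only through its universal property. Even the facts that words span it and
    that its homogeneous components are independent must be extracted by mapping it into suitable
    algebras: the span of the words, and an algebra of operators on sequences that records degrees.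
    In general there is no identity element; finite sums of vertices act as local units, and the
    regular module need not be finitely generated. It therefore enters the dual basis argument only
    as a building block of covers, while the finitely generated projectives that detect a graded
    ideal are the [vertex_grmod v]. Row-finiteness enters where a vertex that is not a sink is
    replaced by a finite sum of products e e^*, in order to shorten ghost paths. Gradedness ensures
    that, once the ghost edges are gone, a combination of paths of one single length remains, from
    which vertices can be extracted. *)

Section AdditiveFunctions.
Variables (U V : zmodType) (f : U -> V).
Hypothesis fD : forall x y, f (x + y) = f x + f y.

Lemma addfun0 : f 0 = 0.
Proof. by apply: (addrI (f 0)); rewrite -fD !addr0. Qed.

Lemma addfunN x : f (- x) = - f x.
Proof. by apply: (addrI (f x)); rewrite -fD !subrr addfun0. Qed.

Lemma addfunB x y : f (x - y) = f x - f y.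
Proof. by rewrite fD addfunN. Qed.

Lemma addfun_sum (T : Type) (s : seq T) (P : pred T) (g : T -> U) :
  f (\sum_(i <- s | P i) g i) = \sum_(i <- s | P i) f (g i).
Proof. exact: (big_morph f fD addfun0). Qed.

End AdditiveFunctions.

Lemma sum_closed (V : zmodType) (J : V -> Prop) (T : Type) (s : seq T)
    (g : T -> V) :
  J 0 -> (forall x y, J x -> J y -> J (x + y)) ->
  (forall i, List.In i s -> J (g i)) -> J (\sum_(i <- s) g i).
Proof.
move=> J0 JD; elim: s => [|i s IH] Js; first by rewrite big_nil.
rewrite big_cons; apply: JD; first by apply: Js; left.
by apply: IH => j js; apply: Js; right.
Qed.

Section NUAlgTheory.
Variables (k : fieldType) (A : nualg k).
Local Notation "x ** y" := (nmul A x y) (at level 40, left associativity).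

Lemma nmul0l x : 0 ** x = 0.
Proof. exact: (addfun0 (f := fun y => y ** x) (fun y z => nmulDl y z x)). Qed.

Lemma nmul0r x : x ** 0 = 0.
Proof. exact: (addfun0 (nmulDr x)). Qed.

Lemma nmulNr x y : x ** (- y) = - (x ** y).
Proof. exact: (addfunN (nmulDr x)). Qed.

Lemma nmul_sumr (T : Type) (s : seq T) (P : pred T) (g : T -> A) x :
  x ** (\sum_(i <- s | P i) g i) = \sum_(i <- s | P i) x ** g i.
Proof. exact: (addfun_sum (nmulDr x)). Qed.

Lemma nmul_suml (T : Type) (s : seq T) (P : pred T) (g : T -> A) x :
  (\sum_(i <- s | P i) g i) ** x = \sum_(i <- s | P i) g i ** x.
Proof.
exact: (addfun_sum (f := fun y => y ** x) (fun y z => nmulDl y z x)).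
Qed.

End NUAlgTheory.

(** * Subalgebras and endomorphism algebras *)

(** The closure proofs are bundled with the predicate so that the module structure on the subtype
    [sub_lmod S] depends on [S] alone. *)
Record closed_lmod (k : fieldType) (V : lmodType k) := ClosedLmod {
  cl_pred :> V -> Prop;
  cl_pred0 : cl_pred 0;
  cl_predP : forall a x y, cl_pred x -> cl_pred y -> cl_pred (a *: x + y) }.

Section SubLmod.
Variables (k : fieldType) (V : lmodType k) (S : closed_lmod V).

Definition cl_bool : {pred V} := fun x => `[< S x >].

Lemma cl_bool_closed : submod_closed cl_bool.
Proof.
split=> [|a x y]; first by apply/asboolP/cl_pred0.
rewrite !unfold_in => /asboolP Sx /asboolP Sy.
by apply/asboolP/cl_predP.
Qed.

HB.instance Definition _ :=
  GRing.isSubmodClosed.Build k V cl_bool cl_bool_closed.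

Record sub_lmod := SubLmod { sl_val : V; slP : sl_val \in cl_bool }.
HB.instance Definition _ := [isSub for sl_val].
HB.instance Definition _ := [Choice of sub_lmod by <:].
HB.instance Definition _ := [SubChoice_isSubLmodule of sub_lmod by <:].

Lemma sl_valP (x : sub_lmod) : S (sl_val x).
Proof. exact/asboolP/(slP x). Qed.

Definition sl_make x (Sx : S x) : sub_lmod := SubLmod (introT (asboolP _) Sx).

Lemma sl_val_lin a (x y : sub_lmod) :
  sl_val (a *: x + y) = a *: sl_val x + sl_val y.
Proof. by []. Qed.

Lemma sl_inj : injective sl_val.
Proof. exact: val_inj. Qed.

End SubLmod.

Section SubAlgebra.
Variables (k : fieldType) (A : nualg k) (S : closed_lmod A).
Hypothesis SM : forall x y, S x -> S y -> S (nmul A x y).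

Definition sub_mul (x y : sub_lmod S) : sub_lmod S :=
  sl_make (SM (sl_valP x) (sl_valP y)).

Definition sub_nualg : nualg k.
Proof.
apply: (@NUAlg k (sub_lmod S) sub_mul).
- by move=> x y z; apply: sl_inj; exact: nmulA.
- by move=> x y z; apply: sl_inj; exact: nmulDl.
- by move=> x y z; apply: sl_inj; exact: nmulDr.
- by move=> a x y; apply: sl_inj; exact: nmulZl.
- by move=> a x y; apply: sl_inj; exact: nmulZr.
Defined.

End SubAlgebra.

Section EndAlgebra.
Variables (k : fieldType) (V : lmodType k).

Definition is_lin (f : V -> V) : Prop :=
  forall a x y, f (a *: x + y) = a *: f x + f y.

Lemma is_lin0 : is_lin 0.
Proof. by move=> a x y; rewrite /= scaler0 addr0. Qed.

Lemma is_linP a f g : is_lin f -> is_lin g -> is_lin (a *: f + g).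
Proof.
move=> Hf Hg b x y; rewrite !fctE Hf Hg !scalerDr !scalerA (mulrC a b).
by rewrite addrACA.
Qed.

Definition lin_closed : closed_lmod (V -> V : lmodType k) :=
  ClosedLmod is_lin0 is_linP.

Lemma is_lin_comp f g : is_lin f -> is_lin g -> is_lin (f \o g).
Proof. by move=> Hf Hg a x y; rewrite /= Hg Hf. Qed.

Definition end_mul (x y : sub_lmod lin_closed) : sub_lmod lin_closed :=
  @sl_make _ _ lin_closed _ (is_lin_comp (sl_valP x) (sl_valP y)).

Lemma is_linD f : is_lin f -> forall x y, f (x + y) = f x + f y.
Proof. by move=> Hf x y; have := Hf 1 x y; rewrite !scale1r. Qed.

Lemma is_linZ f : is_lin f -> forall a x, f (a *: x) = a *: f x.
Proof.
by move=> Hf a x; have := Hf a x 0; rewrite (addfun0 (is_linD Hf)) !addr0.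
Qed.

(** The product is composition. The representation that detects degrees takes its values in such an
    algebra. *)
Definition end_nualg : nualg k.
Proof.
apply: (@NUAlg k (sub_lmod lin_closed) end_mul).
- by move=> x y z; apply: sl_inj.
- by move=> x y z; apply: sl_inj.
- by move=> x y z; apply: sl_inj; apply: funext => v; exact: (is_linD (sl_valP x)).
- by move=> a x y; apply: sl_inj.
- by move=> a x y; apply: sl_inj; apply: funext => v; exact: (is_linZ (sl_valP x)).
Defined.

End EndAlgebra.

(** * Words in a Leavitt family and their span *)

Section LeavittFamily.
Variables (k : fieldType) (E : graph) (A : nualg k) (F : lfam E A).
Local Notation "x ** y" := (nmul A x y) (at level 40, left associativity).
Local Notation word := (gen E * seq (gen E))%type.

Section Relations.
Hypothesis LF : leavitt_family F.

Lemma lf_vv v : fv F v ** fv F v = fv F v.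
Proof. exact: LF.1. Qed.

Lemma lf_vw v w : v <> w -> fv F v ** fv F w = 0.
Proof. exact: LF.2.1. Qed.

Lemma lf_src_e e : fv F (src e) ** fe F e = fe F e.
Proof. exact: (LF.2.2.1 e).1. Qed.

Lemma lf_e_rng e : fe F e ** fv F (rng e) = fe F e.
Proof. exact: (LF.2.2.1 e).2. Qed.

Lemma lf_rng_s e : fv F (rng e) ** fs F e = fs F e.
Proof. exact: (LF.2.2.2.1 e).1. Qed.

Lemma lf_s_src e : fs F e ** fv F (src e) = fs F e.
Proof. exact: (LF.2.2.2.1 e).2. Qed.

Lemma lf_se e : fs F e ** fe F e = fv F (rng e).
Proof. exact: LF.2.2.2.2.1. Qed.

Lemma lf_sf e f : e <> f -> fs F e ** fe F f = 0.
Proof. exact: LF.2.2.2.2.2.1. Qed.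

Lemma lf_ck2 v l : ~ is_sink v -> List.NoDup l ->
  (forall e, src e = v <-> List.In e l) ->
  fv F v = \sum_(e <- l) fe F e ** fs F e.
Proof. exact: LF.2.2.2.2.2.2. Qed.

(** Among orthogonal idempotents only the summand [v] survives. The type [{classic vert E}] supplies
    the decidable equality that [uniq] and membership require. *)
Lemma vertex_sum_unit (v : {classic vert E}) (l : seq {classic vert E}) :
  uniq l -> v \in l -> fv F v ** \sum_(w <- l) fv F w = fv F v.
Proof.
move=> ul vl; rewrite nmul_sumr (bigD1_seq v) //= lf_vv big1 ?addr0 //.
by move=> w /eqP wv; apply: lf_vw => vw; apply: wv.
Qed.

Lemma gen_right_vertex g : exists v, gen_val F g ** fv F v = gen_val F g.
Proof.
case: g => [v|e|e]; first by exists v; exact: lf_vv.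
  by exists (rng e); exact: lf_e_rng.
by exists (src e); exact: lf_s_src.
Qed.

Lemma foldl_word x (s : seq (gen E)) y :
  y ** foldl (fun x g => x ** gen_val F g) x s =
  foldl (fun x g => x ** gen_val F g) (y ** x) s.
Proof. by elim: s x => //= g s IH x; rewrite IH nmulA. Qed.

Lemma word_val_mul (w t : word) :
  word_val F w ** word_val F t = word_val F (w.1, w.2 ++ t.1 :: t.2).
Proof. by rewrite /word_val /= foldl_cat foldl_word. Qed.

Lemma word_deg_mul (w t : word) :
  word_deg (w.1, w.2 ++ t.1 :: t.2) = word_deg w + word_deg t.
Proof. by rewrite /word_deg /= big_cat big_cons !addrA. Qed.

Lemma word_val_rcons g s h :
  word_val F (g, rcons s h) = word_val F (g, s) ** gen_val F h.
Proof. by rewrite /word_val /= foldl_rcons. Qed.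

Lemma word_deg_rcons (g : gen E) s h :
  word_deg (g, rcons s h) = word_deg (g, s) + gen_deg h.
Proof. by rewrite /word_deg /= big_rcons /= addrA [_ + gen_deg h]addrC. Qed.

Lemma word_right_vertex w : exists v, word_val F w ** fv F v = word_val F w.
Proof.
case: w => g; case/lastP=> [|s h]; first exact: gen_right_vertex.
rewrite word_val_rcons; have [v Hv] := gen_right_vertex h.
by exists v; rewrite -nmulA Hv.
Qed.

End Relations.

Lemma homog0 n : homog F n 0.
Proof. by exists [::]; rewrite big_nil. Qed.

Lemma homogP n a x y : homog F n x -> homog F n y -> homog F n (a *: x + y).
Proof.
move=> [s [Hs ->]] [t [Ht ->]].
exists ([seq (a * p.1, p.2) | p <- s] ++ t); split.
  move=> p /List.in_app_iff [|]; last exact: Ht.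
  by move=> /List.in_map_iff [q [<- qs]]; exact: (Hs q).
rewrite big_cat big_map scaler_sumr; congr (_ + _).
by apply: eq_bigr => p _; rewrite scalerA.
Qed.

Lemma homogB n x y : homog F n x -> homog F n y -> homog F n (x - y).
Proof. by move=> Hx Hy; rewrite addrC -scaleN1r; exact: homogP. Qed.

Lemma homog_word w : homog F (word_deg w) (word_val F w).
Proof.
exists [:: (1, w)]; split; first by move=> p [<-|].
by rewrite big_seq1 scale1r.
Qed.

Lemma homog_vertex v : homog F 0 (fv F v).
Proof.
have := homog_word (GV v, [::]).
by rewrite /word_deg big_nil.
Qed.

Lemma homog_elim n (J : A -> Prop) :
  J 0 -> (forall a x y, J x -> J y -> J (a *: x + y)) ->
  (forall w, word_deg w = n -> J (word_val F w)) ->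
  forall x, homog F n x -> J x.
Proof.
move=> J0 JP Jw x [s [Hs ->]]; elim: s Hs => [|p s IH] Hs.
  by rewrite big_nil.
rewrite big_cons; apply: JP.
  by apply: Jw; apply: Hs; left.
by apply: IH => q qs; apply: Hs; right.
Qed.

Lemma homogM m n x y : homog F m x -> homog F n y -> homog F (m + n) (x ** y).
Proof.
move=> Hx Hy; apply: (homog_elim (J := fun x => homog F _ (x ** y))) Hx.
- by rewrite nmul0l; exact: homog0.
- by move=> a u v Hu Hv; rewrite nmulDl nmulZl; exact: homogP.
move=> w <-; apply: (homog_elim (J := fun y => homog F _ (_ ** y))) Hy.
- by rewrite nmul0r; exact: homog0.
- by move=> a u v Hu Hv; rewrite nmulDr nmulZr; exact: homogP.
by move=> t <-; rewrite word_val_mul -word_deg_mul; exact: homog_word.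
Qed.

Definition wspan (x : A) : Prop :=
  exists s : seq (k * word), x = \sum_(p <- s) p.1 *: word_val F p.2.

Lemma wspan0 : wspan 0.
Proof. by exists [::]; rewrite big_nil. Qed.

Lemma wspanP a x y : wspan x -> wspan y -> wspan (a *: x + y).
Proof.
move=> [s ->] [t ->]; exists ([seq (a * p.1, p.2) | p <- s] ++ t).
rewrite big_cat big_map scaler_sumr; congr (_ + _).
by apply: eq_bigr => p _; rewrite scalerA.
Qed.

Lemma wspan_word w : wspan (word_val F w).
Proof. by exists [:: (1, w)]; rewrite big_seq1 scale1r. Qed.

Lemma wspan_elim (J : A -> Prop) :
  J 0 -> (forall a x y, J x -> J y -> J (a *: x + y)) ->
  (forall w, J (word_val F w)) ->
  forall x, wspan x -> J x.
Proof.
move=> J0 JP Jw x [s ->]; elim: s => [|p s IH]; first by rewrite big_nil.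
by rewrite big_cons; apply: JP.
Qed.

Lemma wspanM x y : wspan x -> wspan y -> wspan (x ** y).
Proof.
move=> Hx Hy; apply: (wspan_elim (J := fun x => wspan (x ** y))) Hx.
- by rewrite nmul0l; exact: wspan0.
- by move=> a u v Hu Hv; rewrite nmulDl nmulZl; exact: wspanP.
move=> w; apply: (wspan_elim (J := fun y => wspan (_ ** y))) Hy.
- by rewrite nmul0r; exact: wspan0.
- by move=> a u v Hu Hv; rewrite nmulDr nmulZr; exact: wspanP.
by move=> t; rewrite word_val_mul; exact: wspan_word.
Qed.

Definition wspan_closed : closed_lmod A := ClosedLmod wspan0 wspanP.
Definition wspan_alg : nualg k := @sub_nualg k A wspan_closed wspanM.

Definition wspan_gen g : wspan_alg :=
  @sl_make _ _ wspan_closed _ (wspan_word (g, [::])).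

Definition wspan_fam : lfam E wspan_alg :=
  LFam (fun v => wspan_gen (GV v)) (fun e => wspan_gen (GE e))
       (fun e => wspan_gen (GS e)).

Lemma sl_val_sum (S : closed_lmod A) (T : Type) (s : seq T)
    (g : T -> sub_lmod S) :
  sl_val (\sum_(i <- s) g i) = \sum_(i <- s) sl_val (g i).
Proof. by apply: addfun_sum. Qed.

Lemma wspan_fam_leavitt : leavitt_family F -> leavitt_family wspan_fam.
Proof.
move=> LF; repeat split; intros; apply: sl_inj => /=.
- exact: lf_vv.
- exact: lf_vw.
- exact: lf_src_e.
- exact: lf_e_rng.
- exact: lf_rng_s.
- exact: lf_s_src.
- exact: lf_se.
- exact: lf_sf.
by rewrite sl_val_sum; exact: lf_ck2.
Qed.

(* The universal map onto the span of words, composed with the inclusion,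
   is the identity by uniqueness. *)
Lemma leavitt_wspan : is_leavitt_path_algebra F -> forall x, wspan x.
Proof.
move=> [LF UP] x.
have [[h [[hl hM] [hv [he hs]]]] _] := UP _ _ (wspan_fam_leavitt LF).
suff -> : x = sl_val (h x) by exact: (sl_valP (h x)).
have [_ UU] := UP A F LF.
apply: (UU id (fun x => sl_val (h x))) => //.
- by split=> [a y z|y z]; rewrite ?hl ?hM.
- by move=> v; rewrite hv.
- by move=> e; rewrite he.
- by move=> e; rewrite hs.
Qed.

End LeavittFamily.

(** * Local units and independence of the homogeneous components *)

Section Grading.
Variables (k : fieldType) (E : graph) (A : nualg k) (F : lfam E A).
Hypothesis LPA : is_leavitt_path_algebra F.
Local Notation "x ** y" := (nmul A x y) (at level 40, left associativity).
Let LF : leavitt_family F := LPA.1.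

Lemma leavitt_ind (J : A -> Prop) :
  J 0 -> (forall a x y, J x -> J y -> J (a *: x + y)) ->
  (forall w, J (word_val F w)) -> forall x, J x.
Proof.
move=> J0 JP Jw x; exact: (wspan_elim J0 JP Jw) (leavitt_wspan LPA x).
Qed.

Lemma homog_dec x : exists s : seq (int * A),
  (forall p, List.In p s -> homog F p.1 p.2) /\ x = \sum_(p <- s) p.2.
Proof.
have [s ->] := leavitt_wspan LPA x.
exists [seq (word_deg p.2, p.1 *: word_val F p.2) | p <- s].
rewrite big_map; split=> // p /List.in_map_iff [q [<- _]] /=.
rewrite -[_ *: _]addr0; apply: homogP; [exact: homog_word | exact: homog0].
Qed.

Lemma leavitt_graded_ind (J : A -> Prop) :
  J 0 -> (forall x y, J x -> J y -> J (x + y)) ->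
  (forall n x, homog F n x -> J x) -> forall x, J x.
Proof.
move=> J0 JD Jh x; have [s [Hs ->]] := homog_dec x.
by apply: sum_closed => // p /Hs; exact: Jh.
Qed.

(** The unit property is claimed for every duplicate-free list containing [l], because a sum of two
    elements needs one list that serves both. *)
Lemma right_local_unit_ext x : exists l : seq {classic vert E},
  forall l' : seq {classic vert E}, uniq l' -> {subset l <= l'} ->
  x ** (\sum_(v <- l') fv F v) = x.
Proof.
elim/leavitt_ind: x => [|a x y [l Hl] [m Hm]|w].
- by exists [::] => l' _ _; rewrite nmul0l.
- exists (l ++ m) => l' ul' sl'; rewrite nmulDl nmulZl Hl ?Hm //.
    by move=> v vm; apply: sl'; rewrite mem_cat vm orbT.
  by move=> v vl; apply: sl'; rewrite mem_cat vl.
have [v Hv] := word_right_vertex LF w; exists [:: (v : {classic _})].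
move=> l' ul' sl'; rewrite -{1}Hv -nmulA vertex_sum_unit //.
by apply: sl'; rewrite mem_head.
Qed.

Lemma right_local_unit x :
  exists l : seq {classic vert E}, x ** (\sum_(v <- l) fv F v) = x.
Proof.
have [l Hl] := right_local_unit_ext x; exists (undup l).
by apply: Hl; [exact: undup_uniq | move=> v; rewrite mem_undup].
Qed.

Section ShiftOperators.
Local Notation V := (int -> A).

(** With a sequence [f] read as a two-sided formal series in a variable t, this is multiplication by
    x t^n. *)
Definition shift_op (n : int) (x : A) (f : V) : V := fun i => x ** f (i - n).

Lemma shift_op_lin n x : is_lin (V := V) (shift_op n x).
Proof.
by move=> a f g; apply: funext => i; rewrite /shift_op !fctE nmulDr nmulZr.
Qed.

Definition shift_end n x : end_nualg V :=
  @sl_make _ _ (lin_closed V) _ (shift_op_lin n x).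

Lemma shift_endP n a x y :
  shift_end n (a *: x + y) = a *: shift_end n x + shift_end n y.
Proof.
apply: sl_inj; apply: funext => f; apply: funext => i.
by rewrite sl_val_lin /= /shift_op !fctE nmulDl nmulZl.
Qed.

Lemma shift_endM m n x y :
  nmul (end_nualg V) (shift_end m x) (shift_end n y) =
  shift_end (m + n) (x ** y).
Proof.
apply: sl_inj; apply: funext => f; apply: funext => i.
by rewrite /= /shift_op nmulA opprD addrA.
Qed.

Lemma shift_end0 n : shift_end n 0 = 0.
Proof.
apply: sl_inj; apply: funext => f; apply: funext => i.
by rewrite /= /shift_op nmul0l.
Qed.

Lemma shift_end_sum n (T : Type) (s : seq T) (g : T -> A) :
  shift_end n (\sum_(i <- s) g i) = \sum_(i <- s) shift_end n (g i).
Proof.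
elim: s => [|i s IH]; first by rewrite !big_nil shift_end0.
by rewrite !big_cons -IH -[g i]scale1r shift_endP !scale1r.
Qed.

Definition shift_gen g := shift_end (gen_deg g) (gen_val F g).

Definition shift_fam : lfam E (end_nualg V) :=
  LFam (fun v => shift_gen (GV v)) (fun e => shift_gen (GE e))
       (fun e => shift_gen (GS e)).

(** The Leavitt relations are homogeneous for [gen_deg], so the two sides of each relation translate
    sequences by the same amount. *)
Lemma shift_fam_leavitt : leavitt_family shift_fam.
Proof.
repeat split; intros; try apply: (etrans (shift_endM _ _ _ _)) => /=.
- by rewrite lf_vv.
- by rewrite lf_vw // shift_end0.
- by rewrite lf_src_e.
- by rewrite lf_e_rng.
- by rewrite lf_rng_s.
- by rewrite lf_s_src.
- by rewrite lf_se.
- by rewrite lf_sf // shift_end0.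
rewrite /= /shift_gen /= (lf_ck2 LF H H0 H1) shift_end_sum.
by apply: eq_bigr => e _; apply: esym; exact: (shift_endM 1 (-1)).
Qed.

(* Components are read off by letting [A] act on sequences [int -> A], a
   homogeneous element of degree [n] acting with a translation by [n]. *)
Lemma leavitt_grading_indep (s : seq (int * A)) :
  (forall p, List.In p s -> homog F p.1 p.2) -> \sum_(p <- s) p.2 = 0 ->
  forall g, \sum_(p <- s | p.1 == g) p.2 = 0.
Proof.
have [[h [[hl hM] [hv [he hs]]]] _] := LPA.2 _ _ shift_fam_leavitt.
have hg g : h (gen_val F g) = shift_gen g by case: g.
have hD x y : h (x + y) = h x + h y.
  by have := hl 1 x y; rewrite !scale1r.
have hw w : h (word_val F w) = shift_end (word_deg w) (word_val F w).
  case: w => g; elim/last_ind=> [|s' a IH].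
    by rewrite /word_val /word_deg /= big_nil addr0 hg.
  by rewrite word_val_rcons hM IH hg shift_endM word_deg_rcons.
have hh n x : homog F n x -> h x = shift_end n x.
  apply: (homog_elim (J := fun x => h x = shift_end n x)) => [|a y z Hy Hz|w <-].
  - by rewrite (addfun0 hD) shift_end0.
  - by rewrite hl Hy Hz shift_endP.
  - exact: hw.
move=> Hs s0 g; set y := \sum_(p <- s | _) _.
have [l] := right_local_unit y; set u := \sum_(v <- l) _ => <-.
(* The local unit [u], placed at index 0, replaces the missing identity: for [z] homogeneous of
   degree d, [D z] is [z ** u] if d = g and 0 otherwise. Hence [D] sends the whole vanishing sum to
   [y ** u], which is [y]. *)
pose f : V := fun i => if i == 0 then u else 0.
pose D z : A := sl_val (h z) f g.
have DD y1 y2 : D (y1 + y2) = D y1 + D y2 by rewrite /D hD.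
rewrite -(addfun0 DD) -s0 (addfun_sum DD) /y {y s0} nmul_suml.
elim: s Hs => [|p s IH] Hs; first by rewrite !big_nil.
rewrite !big_cons IH; last by move=> q qs; apply: Hs; right.
have -> : D p.2 = p.2 ** f (g - p.1).
  by rewrite /D (hh p.1) //; apply: Hs; left.
rewrite /f subr_eq0 [g == _]eq_sym.
by case: ifP => _ //; rewrite nmul0r add0r.
Qed.

End ShiftOperators.
End Grading.

Section TwoSidedIdeals.
Variables (k : fieldType) (A : nualg k) (I : A -> Prop).
Hypothesis idI : two_sided_ideal I.

Lemma ideal0 : I 0.
Proof. by case: idI. Qed.

Lemma idealB x y : I x -> I y -> I (x - y).
Proof. by case: idI => _ + _; apply. Qed.

Lemma idealD x y : I x -> I y -> I (x + y).
Proof.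
move=> Ix Iy; rewrite -[y]opprK -[- y]add0r.
by do 2?apply: idealB => //; exact: ideal0.
Qed.

Lemma idealMl a x : I x -> I (nmul A a x).
Proof. by case: idI => _ _ H /(H a) []. Qed.

Lemma idealMr a x : I x -> I (nmul A x a).
Proof. by case: idI => _ _ H /(H a) []. Qed.

End TwoSidedIdeals.

(** * Graded ideals and vertices *)

Section GradedIdealVertices.
Variables (k : fieldType) (E : graph) (A : nualg k) (F : lfam E A).
Hypotheses (RF : row_finite E) (LPA : is_leavitt_path_algebra F).
Local Notation "x ** y" := (nmul A x y) (at level 40, left associativity).
Let LF : leavitt_family F := LPA.1.

(** Paths grow on the left, so that multiplication by e^* on the left strips the first edge.
    Composability is not imposed, since a product of edges that do not meet is 0. *)
Inductive path_span : nat -> A -> Prop :=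
| PathSpan0 m : path_span m 0
| PathSpanP m a x y :
    path_span m x -> path_span m y -> path_span m (a *: x + y)
| PathSpanV v : path_span 0 (fv F v)
| PathSpanE m e x : path_span m x -> path_span m.+1 (fe F e ** x).

(* [mono_span d n] is the span of the [alpha beta^*] with [alpha], [beta] paths,
   [beta] of length at most [n] and [alpha] longer than [beta] by [d]. *)
Inductive mono_span : int -> nat -> A -> Prop :=
| MonoSpanP d n a x y :
    mono_span d n x -> mono_span d n y -> mono_span d n (a *: x + y)
| MonoSpan0 d n : mono_span d n 0
| MonoSpanU m n x : path_span m x -> mono_span m%:Z n x
| MonoSpanS d n e x :
    mono_span (d + 1) n x -> mono_span d n.+1 (x ** fs F e).

Lemma path_span_vl m x v : path_span m x -> path_span m (fv F v ** x).
Proof.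
elim=> {m x} [m|m a x y _ Hx _ Hy|w|m e x Hx _].
- by rewrite nmul0r; exact: PathSpan0.
- by rewrite nmulDr nmulZr; exact: PathSpanP.
- case: (pselect (v = w)) => [->|vw]; last by rewrite lf_vw //; exact: PathSpan0.
  by rewrite lf_vv //; exact: PathSpanV.
rewrite nmulA -(lf_src_e LF) nmulA.
case: (pselect (v = src e)) => [->|vw].
  by rewrite lf_vv // lf_src_e //; exact: PathSpanE.
by rewrite lf_vw // !nmul0l; exact: PathSpan0.
Qed.

Lemma path_span_vr m x v : path_span m x -> path_span m (x ** fv F v).
Proof.
elim=> {m x} [m|m a x y _ Hx _ Hy|w|m e x _ Hx].
- by rewrite nmul0l; exact: PathSpan0.
- by rewrite nmulDl nmulZl; exact: PathSpanP.
- exact/path_span_vl/PathSpanV.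
- by rewrite -nmulA; exact: PathSpanE.
Qed.

Lemma path_span_edge e : path_span 1 (fe F e).
Proof. by rewrite -(lf_e_rng LF); exact/PathSpanE/PathSpanV. Qed.

Lemma path_span_er m x e : path_span m x -> path_span m.+1 (x ** fe F e).
Proof.
elim=> {m x} [m|m a x y _ Hx _ Hy|w|m f x _ Hx].
- by rewrite nmul0l; exact: PathSpan0.
- by rewrite nmulDl nmulZl; exact: PathSpanP.
- exact/path_span_vl/path_span_edge.
- by rewrite -nmulA; exact: PathSpanE.
Qed.

Lemma mono_span_le d m n x : (m <= n)%N -> mono_span d m x -> mono_span d n x.
Proof.
move=> + H; elim: H n => {d m x} [d m a x y _ Hx _ Hy|d m|m m' x Hx|d m e x _ Hx] n.
- by move=> mn; apply: MonoSpanP; [exact: Hx | exact: Hy].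
- by move=> _; exact: MonoSpan0.
- by move=> _; exact: MonoSpanU.
- by case: n => // n mn; apply: MonoSpanS; exact: Hx.
Qed.

Lemma mono_span_vr d n x v : mono_span d n x -> mono_span d n (x ** fv F v).
Proof.
elim=> {d n x} [d n a x y _ Hx _ Hy|d n|m n x Hx|d n e x Hx _].
- by rewrite nmulDl nmulZl; exact: MonoSpanP.
- by rewrite nmul0l; exact: MonoSpan0.
- exact/MonoSpanU/path_span_vr.
case: (pselect (src e = v)) => [<-|ev]; rewrite -nmulA.
  by rewrite lf_s_src //; exact: MonoSpanS.
by rewrite -(lf_s_src LF) -nmulA lf_vw // !nmul0r; exact: MonoSpan0.
Qed.

(** The new edge cancels the last ghost edge, leaving a vertex, or kills the monomial, or else
    lengthens a path without ghost edges. In each case a positive bound on the ghost part drops by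
    one. *)
Lemma mono_span_er d n x e :
  mono_span d n x -> mono_span (d + 1) n.-1 (x ** fe F e).
Proof.
elim=> {d n x} [d n a x y _ Hx _ Hy|d n|m n x Hx|d n f x Hx _].
- by rewrite nmulDl nmulZl; exact: MonoSpanP.
- by rewrite nmul0l; exact: MonoSpan0.
- by rewrite -[1]/(1%:Z) -PoszD addn1; exact/MonoSpanU/path_span_er.
rewrite -nmulA; case: (pselect (f = e)) => [->|fe].
  by rewrite lf_se //; exact: mono_span_vr.
by rewrite lf_sf // nmul0r; exact: MonoSpan0.
Qed.

Lemma mono_span_gen d n x g : mono_span d n x ->
  exists n', mono_span (d + gen_deg g) n' (x ** gen_val F g).
Proof.
move=> Hx; case: g => [v|e|e] /=.
- by exists n; rewrite addr0; exact: mono_span_vr.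
- by exists n.-1; exact: mono_span_er.
- by exists n.+1; apply: MonoSpanS; rewrite subrK.
Qed.

(** Appending a generator on the right keeps the shape of the monomials, so words are reduced letter
    by letter; a sum takes the larger of two bounds. *)
Lemma homog_mono_span d x : homog F d x -> exists n, mono_span d n x.
Proof.
apply: (homog_elim (J := fun x => exists n, mono_span d n x)).
- by exists 0%N; exact: MonoSpan0.
- move=> a u v [m Hu] [n Hv]; exists (maxn m n); apply: MonoSpanP.
    exact: mono_span_le (leq_maxl _ _) Hu.
  exact: mono_span_le (leq_maxr _ _) Hv.
case=> g s <-; elim/last_ind: s => [|s h [n IH]]; last first.
  by rewrite word_val_rcons word_deg_rcons; exact: mono_span_gen IH.
rewrite /word_deg /word_val /= big_nil addr0.
case: g => [v|e|e] /=.
- by exists 0%N; apply: (MonoSpanU (m := 0)); exact: PathSpanV.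
- by exists 0%N; apply: (MonoSpanU (m := 1)); exact: path_span_edge.
- exists 1%N; rewrite -(lf_rng_s LF); apply: MonoSpanS.
  by apply: (MonoSpanU (m := 0)); exact: PathSpanV.
Qed.

Lemma mono_span_sink d n x v :
  is_sink v -> mono_span d n x -> mono_span d 0 (x ** fv F v).
Proof.
move=> sv; elim=> {d n x} [d n a x y _ Hx _ Hy|d n|m n x Hx|d n e x _ _].
- by rewrite nmulDl nmulZl; exact: MonoSpanP.
- by rewrite nmul0l; exact: MonoSpan0.
- exact/MonoSpanU/path_span_vr.
rewrite -nmulA -(lf_s_src LF) -nmulA (lf_vw LF (sv e)) !nmul0r.
exact: MonoSpan0.
Qed.

(** No ghost edge is left. The alternative [x = 0] accounts for negative [d], for which there are no
    paths. *)
Lemma mono_span_path d x :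
  mono_span d 0 x -> x = 0 \/ exists2 m, d = m%:Z & path_span m x.
Proof.
move Dn: 0%N => n H; elim: H Dn => {d n x} [d n a x y _ Hx _ Hy|d n|m n x Hx|] Dn //.
- case: (Hx Dn) => [->|[m dm Ux]]; first rewrite scaler0 add0r; first exact: Hy.
  case: (Hy Dn) => [->|[m' dm' Uy]]; right; exists m => //; apply: PathSpanP => //.
    exact: PathSpan0.
  by move: Uy; have [->] : m' = m by rewrite dm in dm'; case: dm'.
- by left.
- by right; exists m.
Qed.

Lemma path_span0_vr x v : path_span 0 x -> exists c, x ** fv F v = c *: fv F v.
Proof.
move Dm: 0%N => m H; elim: H Dm => {m x} [m|m a x y _ Hx _ Hy|w|] // Dm.
- by exists 0; rewrite nmul0l scale0r.
- case: (Hx Dm) => c Hc; case: (Hy Dm) => c' Hc'; exists (a * c + c').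
  by rewrite nmulDl nmulZl Hc Hc' scalerDl scalerA.
case: (pselect (w = v)) => [->|wv].
  by exists 1; rewrite scale1r lf_vv.
by exists 0; rewrite scale0r lf_vw.
Qed.

Lemma path_span_sl m x e : path_span m.+1 x -> path_span m (fs F e ** x).
Proof.
move Dm: m.+1 => m1 H.
elim: H m Dm => {m1 x} [m1|m1 a x y _ Hx _ Hy|w|m1 f x Hx _] m Dm //.
- by rewrite nmul0r; exact: PathSpan0.
- by rewrite nmulDr nmulZr; apply: PathSpanP; [exact: Hx|exact: Hy].
case: Dm => ->; rewrite nmulA; case: (pselect (e = f)) => [->|ef].
  by rewrite lf_se //; exact: path_span_vl.
by rewrite lf_sf // nmul0l; exact: PathSpan0.
Qed.

(** The edges are the first edges of the paths occurring in [x]: e e^* fixes a path that begins with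
    e and kills every other path of positive length. As with local units, the inner claim allows the
    list to grow, so that the lists of two summands can be merged. *)
Lemma path_span_edges m x : path_span m.+1 x ->
  exists l : seq {classic edge E}, x = \sum_(e <- l) fe F e ** (fs F e ** x).
Proof.
move=> H; suff [l Hl] : exists l : seq {classic edge E},
    forall l' : seq {classic edge E}, uniq l' -> {subset l <= l'} ->
    (\sum_(e <- l') fe F e ** fs F e) ** x = x.
  exists (undup l); under eq_bigr do rewrite nmulA.
  rewrite -nmul_suml Hl ?undup_uniq // => e; by rewrite mem_undup.
move: H; move Dm: m.+1 => m1 H.
elim: H m Dm => {m1 x} [m1|m1 a x y _ Hx _ Hy|w|m1 f x _ _] m Dm //.
- by exists [::] => l' _ _; rewrite nmul0r.
- have [l Hl] := Hx _ Dm; have [l' Hl'] := Hy _ Dm.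
  exists (l ++ l') => l1 ul1 sl1; rewrite nmulDr nmulZr Hl ?Hl' //.
    by move=> v vm; apply: sl1; rewrite mem_cat vm orbT.
  by move=> v vl; apply: sl1; rewrite mem_cat vl.
exists [:: (f : {classic _})] => l' ul' sl'; rewrite nmulA nmul_suml.
rewrite (bigD1_seq (f : {classic _})) //=; last by apply: sl'; rewrite mem_head.
rewrite -nmulA lf_se // lf_e_rng // big1 ?addr0 // => e /eqP ef.
by rewrite -nmulA lf_sf // nmul0r.
Qed.

Section Containment.
Variables I J : A -> Prop.
Hypotheses (idI : two_sided_ideal I) (idJ : two_sided_ideal J).
Hypothesis IJ : forall v, I (fv F v) -> J (fv F v).

Lemma ideal_right_vertices x : (forall v, J (x ** fv F v)) -> J x.
Proof.
move=> Jv; have [l <-] := right_local_unit LPA x; rewrite nmul_sumr.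
by apply: sum_closed => [|y z|v _]; [exact: ideal0|exact: idealD|].
Qed.

(** Stripping first edges stays inside [I] and leads down to length 0. There [x v] is a multiple of
    [v], and a nonzero coefficient can be inverted, which puts [v] in [I] and so in [J]. *)
Lemma path_span_containment m x : path_span m x -> I x -> J x.
Proof.
elim: m x => [|m IH] x Ux Ix.
  apply: ideal_right_vertices => v.
  have [c Hc] := path_span0_vr v Ux.
  have [c0|c0] := eqVneq c 0; first by rewrite Hc c0 scale0r; exact: ideal0.
  (* An ideal is not assumed closed under scalars, so the scalar is moved into one factor of v v =
     v. *)
  suff Jv : J (fv F v) by rewrite Hc -(lf_vv LF) -nmulZl; exact: idealMl.
  apply: IJ; have -> : fv F v = (c^-1 *: fv F v) ** (x ** fv F v).
    by rewrite Hc nmulZl nmulZr scalerA mulVf // scale1r lf_vv.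
  by apply: idealMl => //; exact: idealMr.
have [l ->] := path_span_edges Ux.
apply: sum_closed => [|y z|e _]; [exact: ideal0|exact: idealD|].
apply: idealMl => //; apply: IH; first exact: path_span_sl.
exact: idealMl.
Qed.

(* At a vertex [v] that is not a sink, [x v] is the sum of the [(x e) e^*], where
   [x e] only needs shorter [beta]; at a sink no nontrivial [beta] survives. *)
Lemma mono_span_containment d n x : mono_span d n x -> I x -> J x.
Proof.
elim: n d x => [|n IH] d x Ux Ix.
  case: (mono_span_path Ux) => [->|[m _ Um]]; first exact: ideal0.
  exact: path_span_containment Um Ix.
apply: ideal_right_vertices => v.
case: (pselect (is_sink v)) => [sv|nsv].
  case: (mono_span_path (mono_span_sink sv Ux)) => [->|[m _ Um]].
    exact: ideal0.
  by apply: path_span_containment Um _; exact: idealMr.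
have [l [ul Hl]] := RF v.
rewrite (lf_ck2 LF nsv ul Hl) nmul_sumr.
apply: sum_closed => [|y z|e _]; [exact: ideal0|exact: idealD|].
rewrite nmulA; apply: idealMr => //; apply: IH; last exact: idealMr Ix.
exact: mono_span_er Ux.
Qed.

(** Gradedness reduces the claim to homogeneous elements of [I], where all monomials share the same
    length difference [d]. *)
Lemma graded_ideal_containment : graded_ideal F I -> forall x, I x -> J x.
Proof.
move=> [_ gI] x /gI [s [Hs ->]].
apply: sum_closed => [|y z|p /Hs [hp Ip]]; [exact: ideal0|exact: idealD|].
by have [n Hn] := homog_mono_span hp; exact: mono_span_containment Hn Ip.
Qed.

End Containment.
End GradedIdealVertices.

Lemma InP (T : eqType) (x : T) (s : seq T) : List.In x s <-> x \in s.
Proof.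
elim: s => [|y s IH] //=; rewrite inE; split.
  by case=> [->|/IH ->]; rewrite ?eqxx ?orbT.
by case/orP=> [/eqP ->|/IH]; [left|right].
Qed.

(** * Graded modules *)

Section GradedGroups.
Variables (M : zmodType) (comp : int -> M -> Prop).
Hypotheses (comp0 : forall g, comp g 0)
  (compB : forall g x y, comp g x -> comp g y -> comp g (x - y)).
Implicit Type s : seq (int * M).

Lemma compD g x y : comp g x -> comp g y -> comp g (x + y).
Proof.
by move=> gx gy; rewrite -[y]opprK; apply: compB => //; rewrite -sub0r; apply: compB.
Qed.

Definition homog_list s := forall p, List.In p s -> comp p.1 p.2.

(** The axioms of [grmod] speak of families with distinct degrees, whereas concatenated lists repeat
    degrees. Merging terms of equal degree passes between the two forms. *)
Definition regroup s : seq (int * M) :=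
  [seq (g, \sum_(p <- s | p.1 == g) p.2) | g <- undup (map fst s)].

Lemma regroup_keys s : map fst (regroup s) = undup (map fst s).
Proof. by rewrite -map_comp map_id. Qed.

Lemma sum_regroup s : \sum_(p <- regroup s) p.2 = \sum_(p <- s) p.2.
Proof.
rewrite big_map; under eq_bigr do rewrite big_mkcond /=.
rewrite exchange_big /= big_seq [RHS]big_seq; apply: eq_bigr => p ps.
rewrite (bigD1_seq p.1) ?undup_uniq ?mem_undup ?map_f //= eqxx big1 ?addr0 //.
by move=> g; rewrite eq_sym => /negPf ->.
Qed.

Lemma homog_regroup s : homog_list s -> homog_list (regroup s).
Proof.
move=> Hs p /List.in_map_iff [g [<- _]] /=.
rewrite big_mkcond; apply: sum_closed => // [x y|q /Hs]; first exact: compD.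
by case: eqP => [->|_].
Qed.

Lemma sum_uniq_key s p : uniq (map fst s) -> List.In p s ->
  \sum_(q <- s | q.1 == p.1) q.2 = p.2.
Proof.
elim: s => //= q s IH /andP [qs us]; rewrite big_cons => -[<-|ps].
  rewrite eqxx big1_seq ?addr0 // => r /andP [/eqP rp rs].
  by rewrite -rp map_f in qs.
case: eqP => [qp|_]; last exact: IH.
by rewrite qp map_f // in qs; exact/InP.
Qed.

Lemma homog_indep_filter :
  (forall s, uniq (map fst s) -> homog_list s -> \sum_(p <- s) p.2 = 0 ->
   forall p, List.In p s -> p.2 = 0) ->
  forall s, homog_list s -> \sum_(p <- s) p.2 = 0 ->
  forall g, \sum_(p <- s | p.1 == g) p.2 = 0.
Proof.
move=> ind s Hs s0 g; case: (boolP (g \in map fst s)) => [gs|ngs]; last first.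
  rewrite big1_seq // => p /andP [/eqP pg ps].
  by rewrite -pg map_f in ngs.
apply: (ind (regroup s) _ (homog_regroup Hs) _ (g, _)).
- by rewrite regroup_keys undup_uniq.
- by rewrite sum_regroup.
by apply/InP; apply/mapP; exists g; rewrite ?mem_undup.
Qed.

End GradedGroups.

Section GradedModules.
Variables (k : fieldType) (E : graph) (A : nualg k) (F : lfam E A).
Implicit Types M N P Q R : grmod F.

Section Constructor.
Variables (M : zmodType) (act : A -> M -> M) (comp : int -> M -> Prop).
Hypotheses
  (actDl : forall a b m, act (a + b) m = act a m + act b m)
  (actDr : forall a m n, act a (m + n) = act a m + act a n)
  (actA : forall a b m, act (nmul A a b) m = act a (act b m))
  (unital : forall m, exists s : seq (A * M), m = \sum_(p <- s) act p.1 p.2)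
  (comp0 : forall g, comp g 0)
  (compB : forall g x y, comp g x -> comp g y -> comp g (x - y))
  (dec : forall m, exists s : seq (int * M),
     homog_list comp s /\ m = \sum_(p <- s) p.2)
  (indep : forall s : seq (int * M), homog_list comp s ->
     \sum_(p <- s) p.2 = 0 -> forall g, \sum_(p <- s | p.1 == g) p.2 = 0)
  (compat : forall g h a m,
     homog F g a -> comp h m -> comp (g + h) (act a m)).

Definition mk_grmod : grmod F.
Proof.
apply: (@GrMod E k A F M act actDl actDr actA unital comp comp0 compB).
- move=> m; have [s [Hs ->]] := dec m; exists (regroup s); split.
    by rewrite regroup_keys undup_uniq.
  by split; [exact: homog_regroup | rewrite sum_regroup].
- by move=> s us Hs s0 p ps; rewrite -(sum_uniq_key us ps); exact: indep.
- exact: compat.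
Defined.

End Constructor.

Lemma grmod_indep M (s : seq (int * M)) : homog_list (gcomp M) s ->
  \sum_(p <- s) p.2 = 0 -> forall g, \sum_(p <- s | p.1 == g) p.2 = 0.
Proof.
apply: homog_indep_filter; [exact: gcomp0 | exact: gcompB | exact: gindep].
Qed.

Lemma grmod_dec M (m : M) : exists s : seq (int * M),
  homog_list (gcomp M) s /\ m = \sum_(p <- s) p.2.
Proof. by have [s [_ Hs]] := gdec m; exists s. Qed.

Lemma grmod_ind M (J : M -> Prop) :
  J 0 -> (forall x y, J x -> J y -> J (x + y)) ->
  (forall g x, gcomp M g x -> J x) -> forall m, J m.
Proof.
move=> J0 JD Jh m; have [s [Hs ->]] := grmod_dec m.
by apply: sum_closed => // p /Hs; exact: Jh.
Qed.

Lemma gact0r M a : gact M a 0 = 0.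
Proof. exact: (addfun0 (gactDr a)). Qed.

Lemma gactNr M a (m : M) : gact M a (- m) = - gact M a m.
Proof. exact: (addfunN (gactDr a)). Qed.

(** Maps of degree [d] are kept as they are while traces and composites are formed; [dhom_shift]
    makes them degree-preserving by shifting the source. *)
Definition dhom (d : int) M N (f : M -> N) : Prop :=
  [/\ (forall x y, f (x + y) = f x + f y),
      (forall a x, f (gact M a x) = gact N a (f x)) &
      (forall g x, gcomp M g x -> gcomp N (g + d) (f x))].

Lemma grhom_dhom M N (f : M -> N) : grhom f -> dhom 0 f.
Proof. by case=> fD fA fg; split=> // g x; rewrite addr0; exact: fg. Qed.

Lemma dhom_comp d e M N P (f : M -> N) (h : N -> P) :
  dhom d f -> dhom e h -> dhom (d + e) (h \o f).
Proof.
move=> [fD fA fg] [hD hA hg]; split=> [x y|a x|g x Hx] /=.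
- by rewrite fD hD.
- by rewrite fA hA.
- by rewrite addrA; exact/hg/fg.
Qed.

Lemma grhom_comp M N P (f : M -> N) (h : N -> P) :
  grhom f -> grhom h -> grhom (h \o f).
Proof.
move=> [fD fA fg] [hD hA hg]; split=> [x y|a x|g x Hx] /=.
- by rewrite fD hD.
- by rewrite fA hA.
- exact/hg/fg.
Qed.

Lemma grhom_add M N (f h : M -> N) :
  grhom f -> grhom h -> grhom (fun x => f x + h x).
Proof.
move=> [fD fA fg] [hD hA hg]; split=> [x y|a x|g x Hx] /=.
- by rewrite fD hD addrACA.
- by rewrite fA hA gactDr.
- by apply: compD; [exact: gcomp0|exact: gcompB|exact: fg|exact: hg].
Qed.

Section Shift.
Variables (n : int) (M : grmod F).

Definition shift_grmod : grmod F.
Proof.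
apply: (@mk_grmod M (gact M) (fun g => gcomp M (g + n))).
- exact: gactDl.
- exact: gactDr.
- exact: gactA.
- exact: gunital.
- by move=> g; exact: gcomp0.
- by move=> g; exact: gcompB.
- move=> m; have [s [Hs ->]] := grmod_dec m.
  exists [seq (p.1 - n, p.2) | p <- s]; rewrite big_map; split=> //.
  by move=> p /List.in_map_iff [q [<- qs]] /=; rewrite subrK; exact: Hs.
- move=> s Hs s0 g.
  pose t := [seq (p.1 + n, p.2) | p <- s].
  have Ht : homog_list (gcomp M) t.
    by move=> p /List.in_map_iff [q [<- qs]] /=; exact: Hs.
  have t0 : \sum_(p <- t) p.2 = 0 by rewrite big_map.
  have := grmod_indep Ht t0 (g + n); rewrite big_map /=; apply: etrans.
  by apply: eq_bigl => p; rewrite (inj_eq (addIr n)).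
- by move=> g h a m ha hm; rewrite -addrA; exact: gcompat.
Defined.

Lemma shift_grmod_iso : shift_iso n M shift_grmod.
Proof. by exists id; split=> //; exists id. Qed.

End Shift.

Lemma dhom_shift d M N (f : M -> N) :
  dhom d f -> @grhom E k A F (shift_grmod (- d) M) N f.
Proof.
by move=> [fD fA fg]; split=> // g x /= /fg; rewrite subrK.
Qed.

Lemma grhom_shift d M N (f : M -> N) :
  grhom f -> @grhom E k A F (shift_grmod d M) (shift_grmod d N) f.
Proof. by move=> [fD fA fg]; split=> // g x; exact: fg. Qed.

Section DirectSum.
Variables M N : grmod F.

Let sum_pair (T : Type) (s : seq T) (f : T -> M) (h : T -> N) :
  \sum_(i <- s) (f i, h i) = (\sum_(i <- s) f i, \sum_(i <- s) h i).
Proof. by elim: s => [|i s IH]; rewrite ?big_nil // !big_cons IH. Qed.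

Definition sum_grmod : grmod F.
Proof.
apply: (@mk_grmod (M * N)%type (fun a z => (gact M a z.1, gact N a z.2))
  (fun g z => gcomp M g z.1 /\ gcomp N g z.2)).
- by move=> a b [x y]; rewrite /= !gactDl.
- by move=> a [x y] [x' y']; rewrite /= !gactDr.
- by move=> a b [x y]; rewrite /= !gactA.
- move=> [x y]; have [s xs] := gunital x; have [t yt] := gunital y.
  exists ([seq (p.1, (p.2, 0)) | p <- s] ++ [seq (p.1, (0, p.2)) | p <- t]).
  rewrite big_cat !big_map /= !sum_pair -xs -yt.
  rewrite big1 => [|i _]; last exact: gact0r.
  rewrite big1 => [|i _]; last exact: gact0r.
  by rewrite -[RHS]/(_, _) addr0 add0r.
- by move=> g; split; exact: gcomp0.
- by move=> g x y [? ?] [? ?]; split; exact: gcompB.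
- move=> [x y]; have [s [Hs xs]] := grmod_dec x.
  have [t [Ht yt]] := grmod_dec y.
  exists ([seq (p.1, (p.2, 0)) | p <- s] ++ [seq (p.1, (0, p.2)) | p <- t]).
  split=> [p /List.in_app_iff [] /List.in_map_iff [q [<- qs]] /=|].
  - by split; [exact: Hs | exact: gcomp0].
  - by split; [exact: gcomp0 | exact: Ht].
  rewrite big_cat !big_map /= !sum_pair -xs -yt !big1 //.
  by rewrite -[RHS]/(_, _) addr0 add0r.
- move=> s Hs s0 g.
  pose t := [seq (p.1, p.2.1) | p <- s]; pose u := [seq (p.1, p.2.2) | p <- s].
  have Ht : homog_list (gcomp M) t.
    by move=> p /List.in_map_iff [q [<- qs]]; case: (Hs q qs).
  have Hu : homog_list (gcomp N) u.
    by move=> p /List.in_map_iff [q [<- qs]]; case: (Hs q qs).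
  have t0 : \sum_(p <- t) p.2 = 0.
    by have := congr1 fst s0; rewrite (addfun_sum (f := fst)) // big_map.
  have u0 : \sum_(p <- u) p.2 = 0.
    by have := congr1 snd s0; rewrite (addfun_sum (f := snd)) // big_map.
  rewrite [LHS]surjective_pairing.
  rewrite (addfun_sum (f := fst)) // (addfun_sum (f := snd)) //.
  have := grmod_indep Ht t0 g; have := grmod_indep Hu u0 g.
  by rewrite !big_map /= => -> ->.
- by move=> g h a [x y] ha [hx hy]; split; exact: gcompat.
Defined.

Lemma sum_grmod_biprod : gr_biprod M N sum_grmod.
Proof.
exists (fun x => (x, 0)), (fun y => (0, y)), fst, snd.
split; first split=> [x y|a x|g x Hx] /=.
- by rewrite -[RHS]/(_, _) addr0.
- by rewrite gact0r.
- by split=> //; exact: gcomp0.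
split; first split=> [x y|a x|g x Hx] /=.
- by rewrite -[RHS]/(_, _) addr0.
- by rewrite gact0r.
- by split=> //; exact: gcomp0.
split; first by split=> // g x [].
split; first by split=> // g x [].
by do !split=> //; move=> [x y]; rewrite -[LHS]/(_, _) /= addr0 add0r.
Qed.

End DirectSum.
End GradedModules.

(** * Retracts of graded modules *)

Section Retracts.
Variables (k : fieldType) (E : graph) (A : nualg k) (F : lfam E A).

(** Idempotent graded endomorphisms: the image is realised as the fixed points. Both the modules
    [A v] and the complements of split summands arise in this way. *)
Record retraction (M : grmod F) := Retraction {
  rt :> M -> M;
  rt_hom : grhom rt;
  rt_idem : forall x, rt (rt x) = rt x }.

Variables (M : grmod F) (r : retraction M).

Lemma rtD x y : r (x + y) = r x + r y.
Proof. by case: (rt_hom r). Qed.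

Definition rt_pred : {pred M} := fun x => r x == x.

Lemma rt_pred_closed : zmod_closed rt_pred.
Proof.
split=> [|x y]; rewrite !unfold_in /rt_pred; first by rewrite (addfun0 rtD).
by move=> /eqP Hx /eqP Hy; rewrite (addfunB rtD) Hx Hy.
Qed.

HB.instance Definition _ := GRing.isZmodClosed.Build M rt_pred rt_pred_closed.

Record retract := Retract { rt_val : M; rt_valP : rt_val \in rt_pred }.
HB.instance Definition _ := [isSub for rt_val].
HB.instance Definition _ := [Choice of retract by <:].
HB.instance Definition _ := [SubChoice_isSubZmodule of retract by <:].

Lemma rt_val_fix (x : retract) : r (rt_val x) = rt_val x.
Proof. exact/eqP/(rt_valP x). Qed.

Lemma rt_val_inj : injective rt_val.
Proof. exact: val_inj. Qed.

Lemma rt_proj_mem x : r x \in rt_pred.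
Proof. by rewrite unfold_in /rt_pred rt_idem. Qed.

Definition rt_proj x : retract := Retract (rt_proj_mem x).

Lemma rt_projK (x : retract) : rt_proj (rt_val x) = x.
Proof. by apply: rt_val_inj; exact: rt_val_fix. Qed.

Lemma rt_projD x y : rt_proj (x + y) = rt_proj x + rt_proj y.
Proof. by apply: rt_val_inj; exact: rtD. Qed.

Lemma rt_valD x y : rt_val (x + y) = rt_val x + rt_val y.
Proof. by []. Qed.

(** Projecting back makes membership automatic; [rt_val_act] shows that it changes nothing. *)
Definition rt_act a (x : retract) : retract := rt_proj (gact M a (rt_val x)).

Lemma rt_val_act a x : rt_val (rt_act a x) = gact M a (rt_val x).
Proof. by rewrite /= -[in RHS](rt_val_fix x); case: (rt_hom r). Qed.

Lemma rt_proj_act a x : rt_proj (gact M a x) = rt_act a (rt_proj x).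
Proof.
apply: rt_val_inj; rewrite rt_val_act /=; by case: (rt_hom r).
Qed.

Definition retract_grmod : grmod F.
Proof.
apply: (@mk_grmod _ _ _ _ retract rt_act (fun g x => gcomp M g (rt_val x))).
- by move=> a b m; apply: rt_val_inj; rewrite rt_valD !rt_val_act gactDl.
- by move=> a m n; apply: rt_val_inj; rewrite !rt_valD !rt_val_act gactDr.
- by move=> a b m; apply: rt_val_inj; rewrite !rt_val_act gactA.
- move=> m; have [s Hs] := gunital (rt_val m).
  exists [seq (p.1, rt_proj p.2) | p <- s].
  rewrite -[m]rt_projK Hs (addfun_sum rt_projD) big_map.
  by apply: eq_bigr => p _; exact: rt_proj_act.
- by move=> g; exact: gcomp0.
- by move=> g x y; exact: gcompB.
- move=> m; have [s [Hs ms]] := grmod_dec (rt_val m).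
  exists [seq (p.1, rt_proj p.2) | p <- s]; split.
    move=> p /List.in_map_iff [q [<- qs]] /=.
    by case: (rt_hom r) => _ _; apply; exact: Hs.
  by rewrite -[LHS]rt_projK ms (addfun_sum rt_projD) big_map.
- move=> s Hs s0 g; apply: rt_val_inj; rewrite (addfun_sum rt_valD).
  pose t := [seq (p.1, rt_val p.2) | p <- s].
  have Ht : homog_list (gcomp M) t.
    by move=> p /List.in_map_iff [q [<- qs]]; exact: Hs.
  have t0 : \sum_(p <- t) p.2 = 0.
    by rewrite big_map -(addfun_sum rt_valD) s0.
  by have := grmod_indep Ht t0 g; rewrite big_map.
- by move=> g h a m ha hm; rewrite rt_val_act; exact: gcompat.
Defined.

Lemma rt_val_grhom : grhom (M := retract_grmod) rt_val.
Proof. by split=> // a x; exact: rt_val_act. Qed.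

Lemma rt_proj_grhom : grhom (N := retract_grmod) rt_proj.
Proof.
split; [exact: rt_projD | exact: rt_proj_act |].
by case: (rt_hom r) => _ _ H g x; exact: H.
Qed.

End Retracts.

(** * Finitely generated projective graded modules *)

Section FinitelyGeneratedProjective.
Variables (k : fieldType) (E : graph) (A : nualg k) (F : lfam E A).
Implicit Types M N P Q R : grmod F.

Definition gen_span M (ms : seq M) (m : M) : Prop :=
  exists s : seq (A * M),
    (forall p, List.In p s -> List.In p.2 ms) /\
    m = \sum_(p <- s) gact M p.1 p.2.

Lemma gen_spanD M (ms : seq M) x y :
  gen_span ms x -> gen_span ms y -> gen_span ms (x + y).
Proof.
move=> [s [Hs ->]] [t [Ht ->]]; exists (s ++ t); rewrite big_cat; split=> //.
by move=> p /List.in_app_iff []; [exact: Hs | exact: Ht].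
Qed.

Lemma gen_span_map M N (f : M -> N) (ms : seq M) (ns : seq N) x :
  grhom f -> (forall m, List.In m ms -> List.In (f m) ns) ->
  gen_span ms x -> gen_span ns (f x).
Proof.
move=> [fD fA _] sub [s [Hs ->]]; exists [seq (p.1, f p.2) | p <- s]; split.
  by move=> p /List.in_map_iff [q [<- qs]]; exact/sub/Hs.
by rewrite (addfun_sum fD) big_map; apply: eq_bigr.
Qed.

Lemma fgp_summand M N (i : N -> M) (p : M -> N) :
  grhom i -> grhom p -> (forall x, p (i x) = x) -> gr_fgp M -> gr_fgp N.
Proof.
move=> hi hp pi [[ms Hms] prM]; split.
  exists (map p ms) => n; rewrite -[n]pi.
  by apply: gen_span_map (Hms _) => // m; exact: List.in_map.
move=> X Y q f hq sq hf.
have [g [hg qg]] := prM X Y q (f \o p) hq sq (grhom_comp hp hf).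
exists (g \o i); split; first exact: grhom_comp.
by move=> x; rewrite /= qg /= pi.
Qed.

Lemma fgp_sum M N : gr_fgp M -> gr_fgp N -> gr_fgp (sum_grmod M N).
Proof.
move=> [[ms Hms] prM] [[ns Hns] prN].
have [iM [iN [pM [pN [hiM [hiN [hpM [hpN [_ [_ ipD]]]]]]]]]] :=
  sum_grmod_biprod M N.
split.
  exists (map iM ms ++ map iN ns) => z; rewrite -[z]ipD; apply: gen_spanD.
    apply: gen_span_map (Hms _) => // m Hm; apply/List.in_app_iff; left.
    exact: List.in_map.
  apply: gen_span_map (Hns _) => // m Hm; apply/List.in_app_iff; right.
  exact: List.in_map.
move=> X Y q f hq sq hf.
have [g [hg qg]] := prM X Y q _ hq sq (grhom_comp hiM hf).
have [h [hh qh]] := prN X Y q _ hq sq (grhom_comp hiN hf).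
exists (fun z => (g \o pM) z + (h \o pN) z); split.
  by apply: grhom_add; exact: grhom_comp.
case: hq hf => qD _ _ [fD _ _] z.
by rewrite qD /= qg qh /= -fD ipD.
Qed.

Lemma fgp_shift n M : gr_fgp M -> gr_fgp (shift_grmod n M).
Proof.
move=> [fgM prM]; split; first exact: fgM.
move=> X Y q f hq sq [fD fA fg].
(* A lifting problem for the shift of [M] by [n] is a lifting problem for [M] with both targets
   shifted by [- n]. *)
have hf : grhom (M := M) (N := shift_grmod (- n) Y) f.
  by split=> // g x Hx; apply: fg; rewrite /= subrK.
have [g [[gD gA gg] qg]] :=
  prM (shift_grmod (- n) X) (shift_grmod (- n) Y) q f (grhom_shift _ hq) sq hf.
by exists g; split=> //; split=> // d x /gg /=; rewrite addrK.
Qed.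

(** Row vectors of length 0 serve as the one-element abelian group. *)
Definition zero_grmod : grmod F.
Proof.
apply: (@mk_grmod _ _ _ _ 'rV[int]_0 (fun _ x => x) (fun _ _ => True)) => //.
- by move=> a b m; rewrite [m]thinmx0 addr0.
- by move=> m; exists [::]; rewrite [m]thinmx0 big_nil.
- by move=> m; exists [::]; rewrite [m]thinmx0 big_nil.
- by move=> s _ _ g; exact: thinmx0.
Defined.

Lemma zero_grmod_eq0 (x : zero_grmod) : x = 0.
Proof. exact: thinmx0. Qed.

Lemma fgp_zero : gr_fgp zero_grmod.
Proof.
split.
  exists [::] => m; exists [::]; rewrite big_nil; split=> //.
  exact: zero_grmod_eq0.
move=> X Y q f hq sq [fD fA fg]; exists (fun=> 0); split.
  split=> [x y|a x|g x _]; rewrite ?addr0 ?gact0r //; exact: gcomp0.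
by case: hq => qD _ _ x; rewrite (addfun0 qD) [x]zero_grmod_eq0 (addfun0 fD).
Qed.

End FinitelyGeneratedProjective.

(** * The regular module and the projectives generated by vertices *)

Section RegularModule.
Variables (k : fieldType) (E : graph) (A : nualg k) (F : lfam E A).
Hypothesis LPA : is_leavitt_path_algebra F.
Local Notation "x ** y" := (nmul A x y) (at level 40, left associativity).
Let LF : leavitt_family F := LPA.1.

Definition regular_grmod : grmod F.
Proof.
apply: (@mk_grmod _ _ _ _ A (nmul A) (homog F)).
- exact: nmulDl.
- exact: nmulDr.
- by move=> a b m; rewrite nmulA.
- move=> m; have [l Hl] := right_local_unit LPA m.
  by exists [:: (m, \sum_(v <- l) fv F v)]; rewrite big_seq1.
- exact: homog0.
- exact: homogB.
- exact: homog_dec.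
- exact: leavitt_grading_indep.
- by move=> g h a m; exact: homogM.
Defined.

Lemma right_mul_dhom d a :
  homog F d a -> dhom d (M := regular_grmod) (N := regular_grmod) (fun x => x ** a).
Proof.
move=> ha; split=> [x y|b x|g x Hx] /=.
- exact: nmulDl.
- by rewrite nmulA.
- exact: homogM.
Qed.

Lemma orbit_dhom d (M : grmod F) (m : M) :
  gcomp M d m -> dhom d (M := regular_grmod) (fun a => gact M a m).
Proof.
move=> hm; split=> [x y|b x|g x Hx] /=.
- exact: gactDl.
- exact: gactA.
- exact: gcompat.
Qed.

Definition vertex_retraction (v : vert E) : retraction regular_grmod.
Proof.
apply: (@Retraction _ _ _ _ regular_grmod (fun x => x ** fv F v)).
- case: (right_mul_dhom (homog_vertex F v)) => ? ? H.
  by split=> // g x /H; rewrite addr0.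
- by move=> x; rewrite -nmulA lf_vv.
Defined.

Definition vertex_grmod v : grmod F := retract_grmod (vertex_retraction v).

Definition vertex_elt v : vertex_grmod v :=
  rt_proj (vertex_retraction v) (fv F v).

Lemma vertex_eltE v : rt_val (vertex_elt v) = fv F v.
Proof. exact: lf_vv. Qed.

Lemma vertex_elt_gen v (x : vertex_grmod v) :
  x = gact (vertex_grmod v) (rt_val x) (vertex_elt v).
Proof.
apply: rt_val_inj; rewrite [RHS](rt_val_act (r := vertex_retraction v)).
by rewrite vertex_eltE -[LHS]rt_val_fix.
Qed.

(** A map out of [A v] is determined by the image of [v]. It lifts as the map sending a to a x, for
    any preimage x of that image in degree 0. *)
Lemma fgp_vertex v : gr_fgp (vertex_grmod v).
Proof.
split.
  exists [:: vertex_elt v] => m; exists [:: (rt_val m, vertex_elt v)].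
  split; first by move=> p [<-|[]]; left.
  by rewrite big_seq1 -vertex_elt_gen.
move=> X Y q f [qD qA qg] sq [fD fA fg].
have [x0 Hx0] := sq (f (vertex_elt v)).
have [s [Hs xs]] := grmod_dec x0.
(* A preimage given by surjectivity need not be homogeneous; its component of degree 0 is again a
   preimage, because [q] preserves degrees. *)
pose x := \sum_(p <- s | p.1 == 0) p.2.
have hx : gcomp X 0 x.
  rewrite /x big_mkcond; apply: sum_closed => [|a b|p /Hs].
  - exact: gcomp0.
  - by apply: compD; [exact: gcomp0|exact: gcompB].
  - by case: eqP => [->|_] // _; exact: gcomp0.
have hv : gcomp Y 0 (f (vertex_elt v)).
  by apply: fg; rewrite /= lf_vv //; exact: homog_vertex.
have qx : q x = f (vertex_elt v).
  pose t := (0, - f (vertex_elt v)) :: [seq (p.1, q p.2) | p <- s].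
  have Ht : homog_list (gcomp Y) t.
    move=> p [<-|/List.in_map_iff [r [<- rs]]] /=; last exact/qg/Hs.
    by rewrite -sub0r; apply: gcompB => //; exact: gcomp0.
  have t0 : \sum_(p <- t) p.2 = 0.
    by rewrite big_cons big_map /= -(addfun_sum qD) -xs Hx0 addNr.
  have := grmod_indep Ht t0 0; rewrite big_cons big_map /=.
  by rewrite -(addfun_sum qD) addrC => /subr0_eq.
exists (fun a : vertex_grmod v => gact X (rt_val a) x); split.
  split=> [a b|a b|g a Ha].
  - by rewrite rt_valD gactDl.
  - by rewrite (rt_val_act (r := vertex_retraction v)) gactA.
  - by rewrite -[g]addr0; exact: gcompat.
by move=> a; rewrite qA qx -fA -vertex_elt_gen.
Qed.

End RegularModule.

(** * Trace ideals *)

Section Covers.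
Variables (k : fieldType) (E : graph) (A : nualg k) (F : lfam E A).
Implicit Types M N P Q R : grmod F.

(** Class and target are both arbitrary: the trace has the regular module as target, and covers of
    [P] use the same notion with target [P]. *)
Inductive hom_span (C : grmod F -> Prop) P : P -> Prop :=
| HomSpan0 : hom_span C 0
| HomSpanD x y : hom_span C x -> hom_span C y -> hom_span C (x + y)
| HomSpanI Q d (f : Q -> P) q : C Q -> dhom d f -> hom_span C (f q).

Lemma hom_span_map C P R d (f : P -> R) x :
  dhom d f -> hom_span C x -> hom_span C (f x).
Proof.
move=> hf; case: (hf) => fD _ _; elim=> {x} [|x y _ Hx _ Hy|Q e h q CQ hh].
- by rewrite (addfun0 fD); exact: HomSpan0.
- by rewrite fD; exact: HomSpanD.
- exact: HomSpanI (f \o h) q CQ (dhom_comp hh hf).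
Qed.

Lemma hom_span_mono (C D : grmod F -> Prop) P (x : P) :
  (forall Q, C Q -> D Q) -> hom_span C x -> hom_span D x.
Proof.
move=> CD; elim=> {x} [|x y _ Hx _ Hy|Q d f q CQ hf].
- exact: HomSpan0.
- exact: HomSpanD.
- exact: HomSpanI _ _ (CD _ CQ) hf.
Qed.

Lemma hom_span_act C P a (x : P) : hom_span C x -> hom_span C (gact P a x).
Proof.
elim=> {x} [|x y _ Hx _ Hy|Q d f q CQ hf].
- by rewrite gact0r; exact: HomSpan0.
- by rewrite gactDr; exact: HomSpanD.
- by case: (hf) => _ fA _; rewrite -fA; exact: HomSpanI CQ hf.
Qed.

Lemma hom_spanN C P (x : P) : hom_span C x -> hom_span C (- x).
Proof.
elim=> {x} [|x y _ Hx _ Hy|Q d f q CQ hf].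
- by rewrite oppr0; exact: HomSpan0.
- by rewrite opprD; exact: HomSpanD.
- by case: (hf) => fD _ _; rewrite -(addfunN fD); exact: HomSpanI CQ hf.
Qed.

Section ClosedClass.
Variable C : grmod F -> Prop.
Hypotheses (C0 : C (zero_grmod F))
  (CD : forall M N, C M -> C N -> C (sum_grmod M N))
  (CS : forall n M, C M -> C (shift_grmod n M)).

Lemma grhom_copair P R R' (p : R -> P) (p' : R' -> P) : grhom p -> grhom p' ->
  grhom (M := sum_grmod R R') (fun z => p z.1 + p' z.2).
Proof.
move=> hp hp'; apply: (grhom_add (M := sum_grmod R R')).
  case: hp => pD pA pg.
  by split=> [x y|a x|g x [Hx _]]; rewrite ?pD ?pA //; exact: pg.
case: hp' => pD pA pg.
by split=> [x y|a x|g x [_ Hx]]; rewrite ?pD ?pA //; exact: pg.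
Qed.

(** Of [C] only closure under zero, sums and shifts is asked. This admits order ideals and also
    classes containing the regular module, as the dual basis argument requires. *)
Lemma hom_span_cover P (x : P) : hom_span C x ->
  exists (R : grmod F) (p : R -> P), [/\ C R, grhom p & exists r, p r = x].
Proof.
elim=> {x} [|x y _ [R [p [CR hp [r pr]]]] _ [R' [p' [CR' hp' [r' pr']]]]
  |Q d f q CQ hf].
- exists (zero_grmod F), (fun=> 0); split=> //; last by exists 0.
  by split=> [x y|a x|g x _]; rewrite ?addr0 ?gact0r //; exact: gcomp0.
- exists (sum_grmod R R'), (fun z => p z.1 + p' z.2); split.
  + exact: CD.
  + exact: grhom_copair.
  + by exists (r, r'); rewrite pr pr'.
- exists (shift_grmod (- d) Q), f; split; [exact: CS|exact: dhom_shift|by exists q].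
Qed.

Lemma hom_span_cover_seq P (ms : seq P) :
  (forall m, List.In m ms -> hom_span C m) ->
  exists (R : grmod F) (p : R -> P),
    [/\ C R, grhom p & forall m, List.In m ms -> exists r, p r = m].
Proof.
elim: ms => [|m ms IH] Hms.
  have [R [p [CR hp _]]] := hom_span_cover (HomSpan0 C P).
  by exists R, p; split.
have [R [p [CR hp [r pr]]]] := hom_span_cover (Hms m (or_introl erefl)).
have [|R' [p' [CR' hp' sp']]] := IH; first by move=> x xs; apply: Hms; right.
exists (sum_grmod R R'), (fun z => p z.1 + p' z.2); split.
- exact: CD.
- exact: grhom_copair.
- move=> x [<-|/sp' [r' pr']].
    by exists (r, 0); case: hp' => p'D _ _; rewrite /= pr (addfun0 p'D) addr0.
  by exists (0, r'); case: hp => pD _ _; rewrite /= pr' (addfun0 pD) add0r.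
Qed.

Lemma fin_gen_cover P : gr_fin_gen P -> (forall x : P, hom_span C x) ->
  exists (R : grmod F) (p : R -> P),
    [/\ C R, grhom p & forall x, exists r, p r = x].
Proof.
move=> [ms Hms] HP.
have [R [p [CR hp sp]]] := hom_span_cover_seq (fun m (_ : List.In m ms) => HP m).
exists R, p; split=> // x; have [s [Hs ->]] := Hms x.
case: (hp) => pD pA _.
apply: (sum_closed (J := fun x => exists r, p r = x)).
- by exists 0; exact: addfun0.
- by move=> _ _ [r <-] [r' <-]; exists (r + r').
- by move=> q /Hs /sp [r <-]; exists (gact R q.1 r).
Qed.

End ClosedClass.

Lemma projective_section P R (p : R -> P) :
  gr_projective P -> grhom p -> (forall x, exists r, p r = x) ->
  exists s : P -> R, grhom s /\ forall x, p (s x) = x.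
Proof. by move=> prP hp sp; apply: (prP R P p id) => //; split. Qed.

Section Complement.
Variables (P R : grmod F) (p : R -> P) (s : P -> R).
Hypotheses (hp : grhom p) (hs : grhom s) (ps : forall x, p (s x) = x).

Lemma complement_grhom : grhom (fun x => x - s (p x)).
Proof.
case: hp hs => pD pA pg [sD sA sg]; split=> [x y|a x|g x Hx].
- by rewrite pD sD opprD addrACA.
- by rewrite pA sA gactDr gactNr.
- by apply: gcompB => //; exact/sg/pg.
Qed.

Lemma complement_idem x :
  x - s (p x) - s (p (x - s (p x))) = x - s (p x).
Proof.
case: hp hs => pD _ _ [sD _ _].
by rewrite (addfunB pD) ps subrr (addfun0 sD) subr0.
Qed.

Definition complement_retraction : retraction R :=
  Retraction complement_grhom complement_idem.

Lemma complement_biprod : gr_biprod P (retract_grmod complement_retraction) R.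
Proof.
exists s, (@rt_val _ _ _ _ _ complement_retraction), p,
  (rt_proj complement_retraction).
split=> //; split; first exact: rt_val_grhom.
split=> //; split; first exact: rt_proj_grhom.
split=> //; split=> [y|z]; [exact: rt_projK | by rewrite /= addrC subrK].
Qed.

End Complement.

Lemma fgp_complement P Q R : gr_biprod P Q R -> gr_fgp R -> gr_fgp Q.
Proof.
move=> [_ [i [_ [q [_ [hi [_ [hq [_ [qi _]]]]]]]]]].
exact: fgp_summand hi hq qi.
Qed.

Lemma Zorder_ideal_hom_span (N : grmod F -> Prop) P :
  Zorder_ideal N -> gr_fgp P -> (forall x : P, hom_span N x) -> N P.
Proof.
move=> [Nf [_ [N0 [ND [NS Nsh]]]]] fP HP.
have C0 : N (zero_grmod F).
  by apply: N0; [exact: fgp_zero | exact: zero_grmod_eq0].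
have CD X Y : N X -> N Y -> N (sum_grmod X Y).
  move=> NX NY; apply: (ND X Y) => //; try exact: Nf.
    by apply: fgp_sum; exact: Nf.
  exact: sum_grmod_biprod.
have CS n X : N X -> N (shift_grmod n X).
  move=> NX; apply: (Nsh n X) => //; first exact/fgp_shift/Nf.
  exact: shift_grmod_iso.
have [R [p [NR hp sp]]] := fin_gen_cover C0 CD CS fP.1 HP.
have [s [hs ps]] := projective_section fP.2 hp sp.
(* The complement is the image of 1 - s p. Closure of [N] under summands is stated within finitely
   generated projectives, so the complement must be one too; it is, as a summand of [R]. *)
have bp := complement_biprod hp hs ps.
exact: NS fP (fgp_complement bp (Nf _ NR)) (Nf _ NR) bp NR.
Qed.

End Covers.

(** * The correspondence between graded ideals and order ideals *)

Section Correspondence.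
Variables (k : fieldType) (E : graph) (A : nualg k) (F : lfam E A).
Implicit Types (I J : A -> Prop) (N : grmod F -> Prop) (P Q R : grmod F).
Local Notation "x ** y" := (nmul A x y) (at level 40, left associativity).

Inductive ideal_mul I P : P -> Prop :=
| IdealMul0 : ideal_mul I 0
| IdealMulD x y : ideal_mul I x -> ideal_mul I y -> ideal_mul I (x + y)
| IdealMulI a x : I a -> ideal_mul I (gact P a x).

Lemma ideal_mul_map I P Q (f : P -> Q) x :
  (forall x y, f (x + y) = f x + f y) ->
  (forall a x, f (gact P a x) = gact Q a (f x)) ->
  ideal_mul I x -> ideal_mul I (f x).
Proof.
move=> fD fA; elim=> {x} [|x y _ Hx _ Hy|a x Ia].
- by rewrite (addfun0 fD); exact: IdealMul0.
- by rewrite fD; exact: IdealMulD.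
- by rewrite fA; exact: IdealMulI.
Qed.

Lemma ideal_mul_mono I J P (x : P) :
  (forall a, I a -> J a) -> ideal_mul I x -> ideal_mul J x.
Proof.
move=> IJ; elim=> {x} [|x y _ Hx _ Hy|a x Ia].
- exact: IdealMul0.
- exact: IdealMulD.
- exact/IdealMulI/IJ.
Qed.

Definition mods_of I P : Prop := gr_fgp P /\ forall x : P, ideal_mul I x.

Lemma mods_of_mono I J P :
  (forall a, I a -> J a) -> mods_of I P -> mods_of J P.
Proof. by move=> IJ [fP HP]; split=> // x; exact: ideal_mul_mono (HP x). Qed.

(** No degree is attached to [f], so one argument covers isomorphisms, projections onto summands and
    shifts. *)
Lemma mods_of_surj I P Q (f : P -> Q) :
  (forall x y, f (x + y) = f x + f y) ->
  (forall a x, f (gact P a x) = gact Q a (f x)) ->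
  (forall y, exists x, f x = y) -> gr_fgp Q -> mods_of I P -> mods_of I Q.
Proof.
move=> fD fA sf fQ [_ HP]; split=> // y; have [x <-] := sf y.
exact: ideal_mul_map.
Qed.

Lemma mods_of_order_ideal I : Zorder_ideal (mods_of I).
Proof.
split; first by move=> P [].
split.
  move=> P Q fQ [f [[fD fA _] [[g _ fg] _]]].
  by apply: mods_of_surj fD fA _ fQ => y; exists (g y).
split.
  by move=> Z fZ Z0; split=> // x; rewrite (Z0 x); exact: IdealMul0.
split.
  move=> P Q R _ _ fR [i [j [p [q [[iD iA _] [[jD jA _] [_ [_ [_ [_ ij]]]]]]]]]].
  move=> [_ HP] [_ HQ]; split=> // z; rewrite -[z]ij.
  by apply: IdealMulD; exact: ideal_mul_map.
split.
  move=> P Q R fP _ _ [i [_ [p [_ [_ [_ [[pD pA _] [_ [pi _]]]]]]]]].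
  by apply: mods_of_surj pD pA _ fP => x; exists (i x).
move=> n P Q fQ [f [fD fA [g _ fg] _]].
by apply: mods_of_surj fD fA _ fQ => y; exists (g y).
Qed.

Lemma mods_of_mul I J K P :
  (forall a b, I a -> J b -> K (a ** b)) ->
  mods_of I P -> mods_of J P -> mods_of K P.
Proof.
move=> IJK [fP HI] [_ HJ]; split=> // x.
elim: {x} (HI x) => [|x y _ Hx _ Hy|a x Ia].
- exact: IdealMul0.
- exact: IdealMulD.
elim: {x} (HJ x) => [|x y _ Hx _ Hy|b x Jb].
- by rewrite gact0r; exact: IdealMul0.
- by rewrite gactDr; exact: IdealMulD.
- by rewrite -gactA; exact/IdealMulI/IJK.
Qed.

Inductive product_ideal I J : A -> Prop :=
| ProductIdeal0 : product_ideal I J 0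
| ProductIdealD x y :
    product_ideal I J x -> product_ideal I J y -> product_ideal I J (x + y)
| ProductIdealI a b : I a -> J b -> product_ideal I J (a ** b).

Definition homog_sum I x := exists s : seq (int * A),
  (forall p, List.In p s -> homog F p.1 p.2 /\ I p.2) /\ x = \sum_(p <- s) p.2.

Lemma homog_sum0 I : homog_sum I 0.
Proof. by exists [::]; rewrite big_nil. Qed.

Lemma homog_sumD I x y : homog_sum I x -> homog_sum I y -> homog_sum I (x + y).
Proof.
move=> [s [Hs ->]] [t [Ht ->]]; exists (s ++ t); rewrite big_cat; split=> //.
by move=> p /List.in_app_iff []; [exact: Hs | exact: Ht].
Qed.

Lemma homog_sumI I n x : homog F n x -> I x -> homog_sum I x.
Proof.
move=> hx Ix; exists [:: (n, x)]; rewrite big_seq1; split=> //.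
by move=> p [<-|[]].
Qed.

Lemma product_ideal_graded I J :
  graded_ideal F I -> graded_ideal F J -> graded_ideal F (product_ideal I J).
Proof.
move=> [idI gI] [idJ gJ]; split; first split.
- exact: ProductIdeal0.
- move=> x y Hx Hy; apply: ProductIdealD => //.
  elim: Hy => {x y Hx} [|x y _ Hx _ Hy|a b Ia Jb].
  + by rewrite oppr0; exact: ProductIdeal0.
  + by rewrite opprD; exact: ProductIdealD.
  + rewrite -nmulNr; apply: ProductIdealI => //.
    by rewrite -sub0r; apply: idealB => //; exact: ideal0.
- move=> c x; elim=> {x} [|x y _ [Hx Hx'] _ [Hy Hy']|a b Ia Jb].
  + by rewrite nmul0l nmul0r; split; exact: ProductIdeal0.
  + by rewrite nmulDl nmulDr; split; exact: ProductIdealD.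
  + rewrite nmulA -[(a ** b) ** c]nmulA.
    by split; apply: ProductIdealI => //; [exact: idealMl|exact: idealMr].
move=> x; elim=> {x} [|x y _ Hx _ Hy|a b Ia Jb].
- exact: homog_sum0.
- exact: homog_sumD.
have [s [Hs ->]] := gI a Ia; have [t [Ht ->]] := gJ b Jb.
rewrite nmul_suml; apply: (sum_closed (J := homog_sum _)) => [|x y|p /Hs [hp Ip]].
- exact: homog_sum0.
- exact: homog_sumD.
rewrite nmul_sumr; apply: (sum_closed (J := homog_sum _)) => [|x y|q /Ht [hq Jq]].
- exact: homog_sum0.
- exact: homog_sumD.
by apply: (homog_sumI (n := p.1 + q.1)); [exact: homogM | exact: ProductIdealI].
Qed.

Hypotheses (RF : row_finite E) (LPA : is_leavitt_path_algebra F).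
Let LF : leavitt_family F := LPA.1.
Local Notation AA := (regular_grmod LPA).

Definition trace_ideal N (x : A) : Prop := @hom_span _ _ _ _ N AA x.

(** Right multiplication by a homogeneous element is a homogeneous endomorphism of the regular
    module, and composing with it makes the trace a right ideal. Homogeneous maps send homogeneous
    elements to homogeneous ones, which gives the grading. *)
Lemma trace_ideal_graded N : graded_ideal F (trace_ideal N).
Proof.
split; first split.
- exact: (HomSpan0 N AA).
- move=> x y Hx Hy; apply: (HomSpanD (P := AA)) => //.
  exact: (hom_spanN (P := AA)).
- move=> a x Hx; split; first exact: (hom_span_act (P := AA)).
  elim/(leavitt_graded_ind LPA): a => [|a b Ha Hb|n a ha].
  + by rewrite nmul0r; exact: (HomSpan0 N AA).
  + by rewrite nmulDr; exact: (HomSpanD (P := AA)).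
  + exact: (hom_span_map (P := AA) (R := AA) (right_mul_dhom LPA ha)).
move=> x; elim=> {x} [|x y _ Hx _ Hy|Q d f q NQ hf].
- exact: homog_sum0.
- exact: homog_sumD.
case: (hf) => fD _ fg; elim/grmod_ind: q => [|x y Hx Hy|g x Hx].
- by rewrite (addfun0 fD); exact: homog_sum0.
- by rewrite fD; exact: homog_sumD.
- by apply: (homog_sumI (n := g + d)); [exact: fg | exact: HomSpanI NQ hf].
Qed.

Lemma trace_ideal_mono N N' :
  (forall P, N P -> N' P) -> forall x, trace_ideal N x -> trace_ideal N' x.
Proof. by move=> NN' x; exact: hom_span_mono. Qed.

(** For homogeneous x in [P], the map sending a to a x is homogeneous from the regular module to
    [P]; composed with the maps defining the trace, it exhibits a x as a sum of images from members
    of [N]. *)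
Lemma mods_of_trace_sub N P :
  Zorder_ideal N -> mods_of (trace_ideal N) P -> N P.
Proof.
move=> ON [fP HP]; apply: Zorder_ideal_hom_span => // x.
elim: {x} (HP x) => [|x y _ Hx _ Hy|a x Ia].
- exact: HomSpan0.
- exact: HomSpanD.
elim/grmod_ind: x => [|x y Hx Hy|g x Hx].
- by rewrite gact0r; exact: HomSpan0.
- by rewrite gactDr; exact: HomSpanD.
exact: (hom_span_map (P := AA) (orbit_dhom LPA Hx)).
Qed.

(* A splitting of a surjection onto [P] from a sum of shifts of the regular
   module is a dual basis; its coordinate maps have values in the trace. *)
Lemma mods_of_trace_sup N P :
  gr_fgp P -> N P -> mods_of (trace_ideal N) P.
Proof.
move=> fP NP; split=> // x.
(* [C] holds of [R] if every composite of homogeneous maps from [P] to [R] and back has its values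
   in the trace times [P]. Letting both degrees vary makes [C] closed under shifts, so that it need
   only be verified for the regular module. *)
pose C R := forall d e (s : P -> R) (p : R -> P), dhom d s -> dhom e p ->
  forall x, ideal_mul (trace_ideal N) (p (s x)).
have C0 : C (zero_grmod F).
  move=> d e s p _ [pD _ _] y.
  by rewrite [s y]zero_grmod_eq0 (addfun0 pD); exact: IdealMul0.
have CD R R' : C R -> C R' -> C (sum_grmod R R').
  move=> CR CR' d e s p hs hp y.
  have [i [j [pr [pr' [hi [hj [hpr [hpr' [_ [_ ij]]]]]]]]]] :=
    sum_grmod_biprod R R'.
  case: (hp) => pD _ _; rewrite -[s y]ij pD; apply: IdealMulD.
    apply: (CR _ _ (pr \o s) (p \o i)).
      exact: dhom_comp hs (grhom_dhom hpr).
    exact: dhom_comp (grhom_dhom hi) hp.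
  apply: (CR' _ _ (pr' \o s) (p \o j)).
    exact: dhom_comp hs (grhom_dhom hpr').
  exact: dhom_comp (grhom_dhom hj) hp.
have CS n R : C R -> C (shift_grmod n R).
  move=> CR d e s p [sD sA sg] [pD pA pg].
  apply: (CR (d + n) (e - n)); split=> // g y Hy.
    by rewrite addrA; exact: sg.
  by rewrite addrCA addrC; apply: pg; rewrite /= subrK.
have CA : C AA.
  move=> d e s p hs [_ pA _] y.
  (* With u the local unit, p (s y) = (s y) p u, and [s y] lies in the trace as a value of a map
     from [P], a member of [N], to the algebra. *)
  have [l Hl] := right_local_unit LPA (s y).
  rewrite -Hl [p _](pA (s y)); apply: IdealMulI.
  exact: (HomSpanI (P := AA) _ NP hs).
have [|R [p [CR hp sp]]] := fin_gen_cover C0 CD CS fP.1.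
  move=> {}x; have [s ->] := gunital x.
  apply: (sum_closed (J := @hom_span _ _ _ _ C P)) => [|y z|q _].
  - exact: HomSpan0.
  - exact: HomSpanD.
  elim/grmod_ind: (q.2) => [|y z Hy Hz|g y Hy].
  - by rewrite gact0r; exact: HomSpan0.
  - by rewrite gactDr; exact: HomSpanD.
  exact: (HomSpanI (Q := AA) _ CA (orbit_dhom LPA Hy)).
have [s [hs ps]] := projective_section fP.2 hp sp.
rewrite -[x]ps; exact: CR (grhom_dhom hs) (grhom_dhom hp) x.
Qed.

Lemma mods_of_trace N P :
  Zorder_ideal N -> mods_of (trace_ideal N) P <-> N P.
Proof.
move=> ON; split; first exact: mods_of_trace_sub.
by move=> NP; apply: mods_of_trace_sup => //; exact: ON.1.
Qed.

(** If I Q = Q, every module map from [Q] to the algebra has its values in [I]. For the converse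
    only vertices [v] in [I] need checking: then [A v] lies inside [I], so each y = y v in [A v] is
    an element of [I] acting on the generator. *)
Lemma trace_mods_of I x :
  graded_ideal F I -> trace_ideal (mods_of I) x <-> I x.
Proof.
move=> gI; have idI := gI.1; split.
  elim=> {x} [|x y _ Hx _ Hy|Q d f q [_ HQ] [fD fA _]].
  - exact: ideal0.
  - exact: idealD.
  elim: {q} (HQ q) => [|x y _ Hx _ Hy|a x Ia].
  - by rewrite (addfun0 fD); exact: ideal0.
  - by rewrite fD; exact: idealD.
  - by rewrite fA; exact: idealMr.
apply: (graded_ideal_containment RF LPA idI _ _ gI).
  exact: (trace_ideal_graded _).1.
move=> v Iv; rewrite -(vertex_eltE LPA v).
have hv := grhom_dhom (rt_val_grhom (vertex_retraction LPA v)).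
apply: (HomSpanI (P := AA) _ _ hv); split; first exact: fgp_vertex.
move=> y; rewrite (vertex_elt_gen y); apply: IdealMulI.
have -> : rt_val y = rt_val y ** fv F v by rewrite -[LHS]rt_val_fix.
exact: idealMl.
Qed.

Lemma graded_prime_mods_of I : graded_prime F I -> Zprime_ideal (mods_of I).
Proof.
move=> [gI pI]; split; first exact: mods_of_order_ideal.
move=> N1 N2 O1 O2 N12.
have g1 := trace_ideal_graded N1; have g2 := trace_ideal_graded N2.
have gK := product_ideal_graded g1 g2.
have sub1 x : product_ideal (trace_ideal N1) (trace_ideal N2) x ->
    trace_ideal N1 x.
  by elim=> {x} [|x y _ Hx _ Hy|a b Ia _];
    [exact: ideal0 g1.1 | exact: idealD g1.1 _ _ Hx Hy | exact: idealMr g1.1 _ _ Ia].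
have sub2 x : product_ideal (trace_ideal N1) (trace_ideal N2) x ->
    trace_ideal N2 x.
  by elim=> {x} [|x y _ Hx _ Hy|a b _ Jb];
    [exact: ideal0 g2.1 | exact: idealD g2.1 _ _ Hx Hy | exact: idealMl g2.1 _ _ Jb].
(* The product is graded, hence it is the trace of its own class of modules. It lies in both traces,
   so this class lies in [N1] and in [N2], and by hypothesis in the class of [I]; taking traces
   gives the inclusion. *)
have KI x : product_ideal (trace_ideal N1) (trace_ideal N2) x -> I x.
  move=> /(trace_mods_of _ gK) Kx; apply/(trace_mods_of _ gI).
  apply: trace_ideal_mono Kx => P KP; apply: N12.
    exact/(mods_of_trace _ O1)/(mods_of_mono sub1).
  exact/(mods_of_trace _ O2)/(mods_of_mono sub2).
case: (pI _ _ g1 g2) => [a b Ia Jb|s1|s2].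
- exact/KI/ProductIdealI.
- by left=> P /(mods_of_trace _ O1); exact: mods_of_mono.
- by right=> P /(mods_of_trace _ O2); exact: mods_of_mono.
Qed.

Lemma Zprime_ideal_trace N : Zprime_ideal N -> graded_prime F (trace_ideal N).
Proof.
move=> [ON pN]; split; first exact: trace_ideal_graded.
move=> I J gI gJ IJN.
case: (pN _ _ (mods_of_order_ideal I) (mods_of_order_ideal J)) => [P PI PJ|s|s].
(* A module fixed by both [I] and [J] is fixed by their product, hence by the trace of [N], and so
   belongs to [N]. *)
- exact/(mods_of_trace _ ON)/(mods_of_mul IJN).
- by left=> x /(trace_mods_of _ gI); exact: trace_ideal_mono.
- by right=> x /(trace_mods_of _ gJ); exact: trace_ideal_mono.
Qed.

End Correspondence.

Theorem theorem3p6 (k : fieldType) (E : graph) (A : nualg k) (F : lfam E A) :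
  row_finite E -> is_leavitt_path_algebra F ->
  exists f : gprimes F -> zprimes F,
    bijective f /\
    forall I J : gprimes F,
      (forall x, sval I x -> sval J x) <->
      (forall M, sval (f I) M -> sval (f J) M).
Proof.
move=> RF LPA.
exists (fun I => exist _ _ (graded_prime_mods_of RF LPA (svalP I))); split.
  exists (fun N => exist _ _ (Zprime_ideal_trace RF LPA (svalP N))).
    (* Points on either side are predicates paired with proofs, so their equality reduces to
       pointwise equivalence by extensionality. *)
    move=> [I pI]; apply: eq_exist; apply: funext => x; apply: propext.
    exact: (trace_mods_of RF LPA _ pI.1).
  move=> [N pN]; apply: eq_exist; apply: funext => P; apply: propext.
  exact: (mods_of_trace LPA _ pN.1).
move=> [I [gI _]] [J [gJ _]] /=; split=> [IJ P|IJ x].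
  exact: mods_of_mono.
move=> /(trace_mods_of RF LPA _ gI) Ix; apply/(trace_mods_of RF LPA _ gJ).
exact: trace_ideal_mono Ix.
Qed.
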